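(* Suppose the EEC computation type $\underline R$ is either a computation-type constant or $\underline I$, and let $(\cdot)^\bullet,(\cdot)^\circ$ be the generic self-translation relative to $\underline R$. Then: (1) If $\Gamma\mid-\vdash t:A$, $\Gamma\mid-\vdash u:A$ and $\Gamma^\bullet\mid-\vdash t^\bullet=u^\bullet:A^\bullet$, then $\Gamma\mid-\vdash t=u:A$. (2) If $\Gamma^\bullet\mid-\vdash t:A^\bullet$, then there exists $\Gamma\mid-\vdash u:A$ with $\Gamma^\bullet\mid-\vdash t=u^\bullet:A^\bullet$. (3) If $\Gamma\mid z{:}\underline A\vdash t:\underline B$, $\Gamma\mid z{:}\underline A\vdash u:\underline B$ and $\Gamma^\bullet\mid k_z{:}\underline B^\circ\vdash t^\circ=u^\circ:\underline A^\circ$, then $\Gamma\mid z{:}\underline A\vdash t=u:\underline B$. (4) If $\Gamma^\bullet\mid k_z{:}\underline B^\circ\vdash t:\underline A^\circ$, then there exists $\Gamma\mid z{:}\underline A\vdash u:\underline B$ with $\Gamma^\bullet\mid k_z{:}\underline B^\circ\vdash t=u^\circ:\underline A^\circ$.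
   Context: **EEC (enriched effect calculus).** There are value-type constants $\alpha,\beta,\ldots$ and a disjoint set of computation-type constants $\underline{\alpha},\underline{\beta},\ldots$. Value types $A,B,C$ and computation types $\underline{A},\underline{B},\underline{C},\underline{D}$ are generated by $A::=\alpha\mid 1\mid A\times B\mid A\to B\mid \underline{A}\mid \underline{A}\multimap\underline{B}$ and $\underline{A}::=\underline{\alpha}\mid\underline{1}\mid\underline{A}\,\&\,\underline{B}\mid A\Rightarrow\underline{B}\mid\underline{I}\mid\ !A\mid\ !A\otimes\underline{B}\mid\underline{0}\mid\underline{A}\oplus\underline{B}$ (every computation type is also a value type; $!A\otimes\underline{B}$ is one primitive binary constructor). Judgements are $\Gamma\mid -\vdash t:A$ and $\Gamma\mid z{:}\underline{A}\vdash t:\underline{B}$, where $\Gamma$ lists distinct variables with value types and the ''stoup'' holds at most one variable, of computation type; with nonempty stoup the result type is a computation type. Below $\Delta$ is empty or $z{:}\underline{D}$. Typing rules: $\Gamma,x{:}A\mid-\vdash x:A$; $\Gamma\mid-\vdash *:1$; pairs $\langle t,u\rangle:A\times B$, projections $\pi_1t,\pi_2t$; $\lambda x{:}A.t:A\to B$ from $\Gamma,x{:}A\mid-\vdash t:B$; application $t\,u$ (all with empty stoup). $\Gamma\mid z{:}\underline A\vdash z:\underline A$; $\Gamma\mid\Delta\vdash\underline{*}:\underline 1$; from $\Gamma\mid\Delta\vdash t:\underline A$, $\Gamma\mid\Delta\vdash u:\underline B$ get $\Gamma\mid\Delta\vdash\langle t,u\rangle_c:\underline A\,\&\,\underline B$,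 and from $\Gamma\mid\Delta\vdash t:\underline A\,\&\,\underline B$ get $\underline\pi_1t:\underline A$, $\underline\pi_2t:\underline B$; from $\Gamma,x{:}A\mid\Delta\vdash t:\underline B$ get $\Gamma\mid\Delta\vdash\underline\lambda x{:}A.t:A\Rightarrow\underline B$; from $\Gamma\mid\Delta\vdash s:A\Rightarrow\underline B$, $\Gamma\mid-\vdash t:A$ get $\Gamma\mid\Delta\vdash s@t:\underline B$; $\Gamma\mid-\vdash\top:\underline I$; from $\Gamma\mid\Delta\vdash t:\underline I$, $\Gamma\mid-\vdash u:\underline A$ get $\Gamma\mid\Delta\vdash \mathrm{let}\ \top\ \mathrm{be}\ t\ \mathrm{in}\ u:\underline A$; from $\Gamma\mid-\vdash t:A$ get $\Gamma\mid-\vdash\,!t:\,!A$; from $\Gamma\mid\Delta\vdash t:\,!A$, $\Gamma,x{:}A\mid-\vdash u:\underline B$ get $\Gamma\mid\Delta\vdash\mathrm{let}\ !x\ \mathrm{be}\ t\ \mathrm{in}\ u:\underline B$; from $\Gamma\mid-\vdash t:A$, $\Gamma\mid\Delta\vdash u:\underline B$ get $\Gamma\mid\Delta\vdash\,!t\otimes u:\,!A\otimes\underline B$; from $\Gamma\mid\Delta\vdash s:\,!A\otimes\underline B$, $\Gamma,x{:}A\mid y{:}\underline B\vdash t:\underline C$ get $\Gamma\mid\Delta\vdash\mathrm{let}\ !x\otimes y\ \mathrm{be}\ s\ \mathrm{in}\ t:\underline C$; from $\Gamma\mid\Delta\vdash t:\underline 0$ get $\Gamma\mid\Delta\vdash\mathrm{abort}_{\underline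 A}(t):\underline A$; $\mathrm{inl}\,t:\underline A\oplus\underline B$ from $t:\underline A$ and $\mathrm{inr}\,t$ from $t:\underline B$ (same $\Gamma\mid\Delta$); from $\Gamma\mid\Delta\vdash s:\underline A\oplus\underline B$, $\Gamma\mid x{:}\underline A\vdash t:\underline C$, $\Gamma\mid y{:}\underline B\vdash u:\underline C$ get $\Gamma\mid\Delta\vdash\mathrm{case}\ s\ \mathrm{of}\ (\mathrm{inl}\,x\Rightarrow t\mid\mathrm{inr}\,y\Rightarrow u):\underline C$; from $\Gamma\mid z{:}\underline A\vdash t:\underline B$ get $\Gamma\mid-\vdash\hat\lambda z{:}\underline A.t:\underline A\multimap\underline B$; from $\Gamma\mid-\vdash s:\underline A\multimap\underline B$, $\Gamma\mid\Delta\vdash t:\underline A$ get $\Gamma\mid\Delta\vdash s\{t\}:\underline B$. Equality $\Gamma\mid\Delta\vdash t=u:A$ is the least typed congruence (equivalence, compatible with all term formers, containing $\alpha$-equivalence) containing all well-typed instances of: $t=*$ for $t:1$; $\pi_1\langle t,u\rangle=t$, $\pi_2\langle t,u\rangle=u$, $\langle\pi_1t,\pi_2t\rangle=t$; $(\lambda x.t)u=t[u/x]$, $\lambda x.(t\,x)=t$ ($x$ not free in $t$); $t=\underline*$ for $t:\underline1$; $\underline\pi_1\langle t,u\rangle_c=t$, $\underline\pi_2\langle t,u\rangle_c=u$, $\langle\underline\pi_1t,\underline\pi_2t\rangle_c=t$; $(\underline\lambda x.t)@u=t[u/x]$, $\underline\lambda x.(t@x)=t$ ($x$ not free); $\mathrm{let}\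 \top\ \mathrm{be}\ \top\ \mathrm{in}\ t=t$; $\mathrm{let}\ \top\ \mathrm{be}\ t\ \mathrm{in}\ u[\top/x]=u[t/x]$ for $\Gamma\mid x{:}\underline I\vdash u:\underline A$; $\mathrm{let}\ !x\ \mathrm{be}\ !t\ \mathrm{in}\ u=u[t/x]$; $\mathrm{let}\ !x\ \mathrm{be}\ t\ \mathrm{in}\ u[!x/y]=u[t/y]$ for $\Gamma\mid y{:}\,!A\vdash u:\underline B$; $\mathrm{let}\ !x\otimes y\ \mathrm{be}\ !t\otimes s\ \mathrm{in}\ u=u[t/x,s/y]$; $\mathrm{let}\ !x\otimes y\ \mathrm{be}\ t\ \mathrm{in}\ u[(!x\otimes y)/z]=u[t/z]$ for $\Gamma\mid z{:}\,!A\otimes\underline B\vdash u:\underline C$; $\mathrm{abort}_{\underline A}(t)=u[t/x]$ for $\Gamma\mid x{:}\underline 0\vdash u:\underline A$; $\mathrm{case}\ \mathrm{inl}\,t\ \mathrm{of}\ (\mathrm{inl}\,x\Rightarrow u\mid\mathrm{inr}\,y\Rightarrow u')=u[t/x]$ and symmetrically for $\mathrm{inr}$; $\mathrm{case}\ t\ \mathrm{of}\ (\mathrm{inl}\,x\Rightarrow u[\mathrm{inl}\,x/z]\mid\mathrm{inr}\,y\Rightarrow u[\mathrm{inr}\,y/z])=u[t/z]$ for $\Gamma\mid z{:}\underline A\oplus\underline B\vdash u:\underline C$; $(\hat\lambda x.t)\{u\}=t[u/x]$, $\hat\lambda x.(t\{x\})=t$ ($x$ not free). **Generic self-translation relative to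 a computation type $\underline R$.** Types: $\alpha^\bullet=\alpha$, $1^\bullet=1$, $(A\times B)^\bullet=A^\bullet\times B^\bullet$, $(A\to B)^\bullet=A^\bullet\to B^\bullet$, $\underline A^\bullet=\underline A^\circ\multimap\underline R$ (a computation type viewed as a value type), $(\underline A\multimap\underline B)^\bullet=\underline B^\circ\multimap\underline A^\circ$; $\underline\alpha^\circ=\underline\alpha$ if $\underline\alpha\neq\underline R$ and $\underline\alpha^\circ=\underline I$ if $\underline R$ is the constant $\underline\alpha$; $\underline1^\circ=\underline0$; $(\underline A\,\&\,\underline B)^\circ=\underline A^\circ\oplus\underline B^\circ$; $(A\Rightarrow\underline B)^\circ=\,!(A^\bullet)\otimes\underline B^\circ$; $\underline I^\circ=\underline R$; $(!A)^\circ=A^\bullet\Rightarrow\underline R$; $(!A\otimes\underline B)^\circ=A^\bullet\Rightarrow\underline B^\circ$; $\underline0^\circ=\underline1$; $(\underline A\oplus\underline B)^\circ=\underline A^\circ\,\&\,\underline B^\circ$. For $\Gamma=x_1{:}C_1,\ldots,x_n{:}C_n$, $\Gamma^\bullet=x_1{:}C_1^\bullet,\ldots,x_n{:}C_n^\bullet$. To each variable $z$ is associated a distinct fresh variable $k_z$ (so iterating gives $k_{k_z}$); $k,h,k_x,k_y$ below are fresh bound variables. Terms: a judgement $\Gamma\mid-\vdash t:A$ goes to $\Gamma^\bullet\mid-\vdash t^\bullet:A^\bullet$, and $\Gamma\mid z{:}\underline D\vdash t:\underline B$ goes to $\Gamma^\bullet\mid k_z{:}\underline B^\circ\vdash t^\circ:\underline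 D^\circ$ (contravariantly); type names below refer to the typing rules. Value clauses: $x^\bullet=x$; $*^\bullet=*$; $\langle t,u\rangle^\bullet=\langle t^\bullet,u^\bullet\rangle$; $(\pi_it)^\bullet=\pi_it^\bullet$; $(\lambda x{:}A.t)^\bullet=\lambda x{:}A^\bullet.t^\bullet$; $(t\,u)^\bullet=t^\bullet\,u^\bullet$; $\underline*^\bullet=\hat\lambda k{:}\underline0.\,\mathrm{abort}_{\underline R}(k)$; $\langle t,u\rangle_c^\bullet=\hat\lambda k{:}\underline A^\circ\oplus\underline B^\circ.\,\mathrm{case}\ k\ \mathrm{of}\ (\mathrm{inl}\,k_x\Rightarrow t^\bullet\{k_x\}\mid\mathrm{inr}\,k_y\Rightarrow u^\bullet\{k_y\})$; $(\underline\pi_1t)^\bullet=\hat\lambda k{:}\underline A^\circ.\,t^\bullet\{\mathrm{inl}\,k\}$; $(\underline\pi_2t)^\bullet=\hat\lambda k{:}\underline B^\circ.\,t^\bullet\{\mathrm{inr}\,k\}$; $(\underline\lambda x{:}A.t)^\bullet=\hat\lambda k{:}\,!A^\bullet\otimes\underline B^\circ.\,\mathrm{let}\ !x\otimes h\ \mathrm{be}\ k\ \mathrm{in}\ t^\bullet\{h\}$; $(s@t)^\bullet=\hat\lambda k{:}\underline B^\circ.\,s^\bullet\{!(t^\bullet)\otimes k\}$; $\top^\bullet=\hat\lambda k{:}\underline R.\,k$; $(\mathrm{let}\ \top\ \mathrm{be}\ t\ \mathrm{in}\ u)^\bullet=\hat\lambda k{:}\underline A^\circ.\,t^\bullet\{u^\bullet\{k\}\}$;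 $(!t)^\bullet=\hat\lambda k{:}A^\bullet\Rightarrow\underline R.\,k@t^\bullet$; $(\mathrm{let}\ !x\ \mathrm{be}\ t\ \mathrm{in}\ u)^\bullet=\hat\lambda k{:}\underline B^\circ.\,t^\bullet\{\underline\lambda x{:}A^\bullet.\,u^\bullet\{k\}\}$; $(!t\otimes u)^\bullet=\hat\lambda k{:}A^\bullet\Rightarrow\underline B^\circ.\,u^\bullet\{k@t^\bullet\}$; $(\mathrm{let}\ !x\otimes y\ \mathrm{be}\ s\ \mathrm{in}\ t)^\bullet=\hat\lambda k{:}\underline C^\circ.\,s^\bullet\{\underline\lambda x{:}A^\bullet.\,t^\circ[k/k_y]\}$; $(\mathrm{abort}_{\underline A}(t))^\bullet=\hat\lambda k{:}\underline A^\circ.\,t^\bullet\{\underline*\}$; $(\mathrm{inl}\,t)^\bullet=\hat\lambda k{:}\underline A^\circ\,\&\,\underline B^\circ.\,t^\bullet\{\underline\pi_1k\}$; $(\mathrm{inr}\,t)^\bullet=\hat\lambda k{:}\underline A^\circ\,\&\,\underline B^\circ.\,t^\bullet\{\underline\pi_2k\}$; $(\mathrm{case}\ s\ \mathrm{of}\ (\mathrm{inl}\,x\Rightarrow t\mid\mathrm{inr}\,y\Rightarrow u))^\bullet=\hat\lambda k{:}\underline C^\circ.\,s^\bullet\{\langle t^\circ[k/k_x],u^\circ[k/k_y]\rangle_c\}$; $(\hat\lambda z{:}\underline A.t)^\bullet=\hat\lambda k{:}\underline B^\circ.\,t^\circ[k/k_z]$; $(s\{t\})^\bullet=\hat\lambda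 k{:}\underline B^\circ.\,t^\bullet\{s^\bullet\{k\}\}$. Computation clauses (stoup $z{:}\underline D$): $z^\circ=k_z$; $\underline*^\circ=\mathrm{abort}_{\underline D^\circ}(k_z)$; $\langle t,u\rangle_c^\circ=\mathrm{case}\ k_z\ \mathrm{of}\ (\mathrm{inl}\,k_x\Rightarrow t^\circ[k_x/k_z]\mid\mathrm{inr}\,k_y\Rightarrow u^\circ[k_y/k_z])$; $(\underline\pi_1t)^\circ=t^\circ[\mathrm{inl}\,k_z/k_z]$; $(\underline\pi_2t)^\circ=t^\circ[\mathrm{inr}\,k_z/k_z]$; $(\underline\lambda x{:}A.t)^\circ=\mathrm{let}\ !x\otimes h\ \mathrm{be}\ k_z\ \mathrm{in}\ t^\circ[h/k_z]$; $(s@t)^\circ=s^\circ[(!(t^\bullet)\otimes k_z)/k_z]$; $(\mathrm{let}\ \top\ \mathrm{be}\ t\ \mathrm{in}\ u)^\circ=t^\circ[u^\bullet\{k_z\}/k_z]$; $(\mathrm{let}\ !x\ \mathrm{be}\ t\ \mathrm{in}\ u)^\circ=t^\circ[(\underline\lambda x{:}A^\bullet.\,u^\bullet\{k_z\})/k_z]$; $(!t\otimes u)^\circ=u^\circ[(k_z@t^\bullet)/k_z]$; $(\mathrm{let}\ !x\otimes y\ \mathrm{be}\ s\ \mathrm{in}\ t)^\circ=s^\circ[(\underline\lambda x{:}A^\bullet.\,t^\circ[k_z/k_y])/k_z]$; $(\mathrm{abort}(t))^\circ=t^\circ[\underline*/k_z]$; $(\mathrm{inl}\,t)^\circ=t^\circ[\underline\pi_1k_z/k_z]$;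 $(\mathrm{inr}\,t)^\circ=t^\circ[\underline\pi_2k_z/k_z]$; $(\mathrm{case}\ s\ \mathrm{of}\ (\mathrm{inl}\,x\Rightarrow t\mid\mathrm{inr}\,y\Rightarrow u))^\circ=s^\circ[\langle t^\circ[k_z/k_x],u^\circ[k_z/k_y]\rangle_c/k_z]$; $(s\{t\})^\circ=t^\circ[s^\bullet\{k_z\}/k_z]$. *)

(* Defs.v *)
From HB Require Import structures.
From mathcomp Require Import all_boot.

Set Implicit Arguments.
Unset Strict Implicit.
Unset Printing Implicit Defensive.

(* The enriched effect calculus, over a set V of value-type constants and a
   set K of computation-type constants.  Terms are intrinsically typed de
   Bruijn terms, so a term is a typing derivation and alpha-equivalence is
   syntactic equality.  K has decidable equality because the translation of a
   constant depends on whether that constant is R. *)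

Section EEC.

Variables (V : Type) (K : eqType).

Inductive vtype : Type :=
| VConst of V
| VOne
| VProd of vtype & vtype
| VArr of vtype & vtype
| VComp of ctype                    (* a computation type as a value type *)
| VLolli of ctype & ctype           (* A -o B *)
with ctype : Type :=
| CConst of K
| COne
| CWith of ctype & ctype
| CArr of vtype & ctype             (* A => B *)
| CI
| CBang of vtype                    (* !A *)
| CTens of vtype & ctype            (* the single constructor !A (x) B *)
| CZero
| CPlus of ctype & ctype.

Coercion VComp : ctype >-> vtype.

Definition ctx := seq vtype.

Definition stoup := option ctype.

Inductive var : ctx -> vtype -> Type :=
| VZ (G : ctx) (A : vtype) : var (A :: G) A
| VS (G : ctx) (A B : vtype) : var G A -> var (B :: G) A.

(* [tm G D A] is the set of derivations of G | D |- _ : A.  The stoup variable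
   is not part of the context, so binding it does not shift indices; it is
   always called [SVar].  Under a non-empty stoup, every constructor has a
   result type of the form [VComp _]. *)
Inductive tm : ctx -> stoup -> vtype -> Type :=
| Var (G : ctx) (A : vtype) : var G A -> tm G None A
| Star (G : ctx) : tm G None VOne
| Pair (G : ctx) (A B : vtype) :
    tm G None A -> tm G None B -> tm G None (VProd A B)
| Fst (G : ctx) (A B : vtype) : tm G None (VProd A B) -> tm G None A
| Snd (G : ctx) (A B : vtype) : tm G None (VProd A B) -> tm G None B
| Lam (G : ctx) (A B : vtype) : tm (A :: G) None B -> tm G None (VArr A B)
| App (G : ctx) (A B : vtype) :
    tm G None (VArr A B) -> tm G None A -> tm G None B
| SVar (G : ctx) (A : ctype) : tm G (Some A) A
| CStar (G : ctx) (D : stoup) : tm G D COne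
| CPair (G : ctx) (D : stoup) (A B : ctype) :
    tm G D A -> tm G D B -> tm G D (CWith A B)
| CFst (G : ctx) (D : stoup) (A B : ctype) : tm G D (CWith A B) -> tm G D A
| CSnd (G : ctx) (D : stoup) (A B : ctype) : tm G D (CWith A B) -> tm G D B
| CLam (G : ctx) (D : stoup) (A : vtype) (B : ctype) :
    tm (A :: G) D B -> tm G D (CArr A B)
| CApp (G : ctx) (D : stoup) (A : vtype) (B : ctype) :
    tm G D (CArr A B) -> tm G None A -> tm G D B
| Top (G : ctx) : tm G None CI
| LetTop (G : ctx) (D : stoup) (A : ctype) :
    tm G D CI -> tm G None A -> tm G D A
| Bang (G : ctx) (A : vtype) : tm G None A -> tm G None (CBang A)
| LetBang (G : ctx) (D : stoup) (A : vtype) (B : ctype) :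
    tm G D (CBang A) -> tm (A :: G) None B -> tm G D B
| Tens (G : ctx) (D : stoup) (A : vtype) (B : ctype) :
    tm G None A -> tm G D B -> tm G D (CTens A B)
| LetTens (G : ctx) (D : stoup) (A : vtype) (B C : ctype) :
    tm G D (CTens A B) -> tm (A :: G) (Some B) C -> tm G D C
| Abort (G : ctx) (D : stoup) (A : ctype) : tm G D CZero -> tm G D A
| Inl (G : ctx) (D : stoup) (A B : ctype) : tm G D A -> tm G D (CPlus A B)
| Inr (G : ctx) (D : stoup) (A B : ctype) : tm G D B -> tm G D (CPlus A B)
| Case (G : ctx) (D : stoup) (A B C : ctype) :
    tm G D (CPlus A B) -> tm G (Some A) C -> tm G (Some B) C -> tm G D C
| LLam (G : ctx) (A B : ctype) : tm G (Some A) B -> tm G None (VLolli A B)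
| LApp (G : ctx) (D : stoup) (A B : ctype) :
    tm G None (VLolli A B) -> tm G D A -> tm G D B.

Arguments VZ {G A}.
Arguments VS {G A} B.
Arguments Star {G}.
Arguments SVar {G A}.
Arguments CStar {G D}.
Arguments Top {G}.
Arguments Abort {G D} A.
Arguments Inl {G D A} B.
Arguments Inr {G D} A {B}.

Definition rename (G G' : ctx) := forall A, var G A -> var G' A.

Definition rup (G G' : ctx) (B : vtype) (r : rename G G') :
    rename (B :: G) (B :: G') := fun A x =>
  match x in var H A
    return match H with
           | [::] => unit
           | C :: H' => rename H' G' -> var (C :: G') A
           end with
  | VZ _ _ => fun=> VZ
  | VS _ _ _ y => fun r => VS _ (r _ y)
  end r.

Fixpoint ren (G : ctx) (D : stoup) (A : vtype) (t : tm G D A) (G' : ctx)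
    (r : rename G G') {struct t} : tm G' D A :=
  match t in tm G D A return rename G G' -> tm G' D A with
  | Var _ _ x => fun r => Var (r _ x)
  | Star _ => fun=> Star
  | Pair _ _ _ t u => fun r => Pair (ren t r) (ren u r)
  | Fst _ _ _ t => fun r => Fst (ren t r)
  | Snd _ _ _ t => fun r => Snd (ren t r)
  | Lam _ _ _ t => fun r => Lam (ren t (rup r))
  | App _ _ _ t u => fun r => App (ren t r) (ren u r)
  | SVar _ _ => fun=> SVar
  | CStar _ _ => fun=> CStar
  | CPair _ _ _ _ t u => fun r => CPair (ren t r) (ren u r)
  | CFst _ _ _ _ t => fun r => CFst (ren t r)
  | CSnd _ _ _ _ t => fun r => CSnd (ren t r)
  | CLam _ _ _ _ t => fun r => CLam (ren t (rup r))
  | CApp _ _ _ _ s t => fun r => CApp (ren s r) (ren t r)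
  | Top _ => fun=> Top
  | LetTop _ _ _ t u => fun r => LetTop (ren t r) (ren u r)
  | Bang _ _ t => fun r => Bang (ren t r)
  | LetBang _ _ _ _ t u => fun r => LetBang (ren t r) (ren u (rup r))
  | Tens _ _ _ _ t u => fun r => Tens (ren t r) (ren u r)
  | LetTens _ _ _ _ _ s t => fun r => LetTens (ren s r) (ren t (rup r))
  | Abort _ _ A t => fun r => Abort A (ren t r)
  | Inl _ _ _ B t => fun r => Inl B (ren t r)
  | Inr _ _ A _ t => fun r => Inr A (ren t r)
  | Case _ _ _ _ _ s t u => fun r => Case (ren s r) (ren t r) (ren u r)
  | LLam _ _ _ t => fun r => LLam (ren t r)
  | LApp _ _ _ _ s t => fun r => LApp (ren s r) (ren t r)
  end r.

Definition wk (G : ctx) (D : stoup) (A B : vtype) (t : tm G D A) :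
    tm (B :: G) D A := ren t (fun _ x => VS B x).

Definition subst (G G' : ctx) := forall A, var G A -> tm G' None A.

Definition idsub (G : ctx) : subst G G := fun _ x => Var x.

Definition scons (G G' : ctx) (B : vtype) (u : tm G' None B)
    (s : subst G G') : subst (B :: G) G' := fun A x =>
  match x in var H A
    return match H with
           | [::] => unit
           | C :: H' => tm G' None C -> subst H' G' -> tm G' None A
           end with
  | VZ _ _ => fun u _ => u
  | VS _ _ _ y => fun _ s => s _ y
  end u s.

Definition sup (G G' : ctx) (B : vtype) (s : subst G G') :
    subst (B :: G) (B :: G') :=
  scons (Var VZ) (fun _ x => wk B (s _ x)).

(* [ssub G D D'] replaces the stoup D by the stoup D': nothing to do if D is
   empty (then so is D'), and a term G | D' |- _ : A if D is a variable of
   type A. *)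
Inductive ssub (G : ctx) : stoup -> stoup -> Type :=
| SNil : ssub G None None
| SOne (A : ctype) (D : stoup) (u : tm G D A) : ssub G (Some A) D.

Arguments SNil {G}.

Definition ssub_wk (G : ctx) (B : vtype) (D D' : stoup) (q : ssub G D D') :
    ssub (B :: G) D D' :=
  match q with
  | SNil => SNil
  | SOne _ _ u => SOne (wk B u)
  end.

Definition ssub_none (G : ctx) (A : vtype) (D' : stoup) (q : ssub G None D')
    (t : tm G None A) : tm G D' A :=
  match q in ssub _ D D'
    return match D with None => tm G D' A | Some _ => unit end with
  | SNil => t
  | SOne _ _ _ => tt
  end.

Definition ssub_some (G : ctx) (A : ctype) (D' : stoup)
    (q : ssub G (Some A) D') : tm G D' A :=
  match q in ssub _ D D'
    return match D with None => unit | Some A => tm G D' A end with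
  | SNil => tt
  | SOne _ _ u => u
  end.

(* Simultaneous substitution for the context and for the stoup. *)
Fixpoint sub (G : ctx) (D : stoup) (A : vtype) (t : tm G D A) (G' : ctx)
    (D' : stoup) (s : subst G G') (q : ssub G' D D') {struct t} : tm G' D' A :=
  match t in tm G D A return subst G G' -> ssub G' D D' -> tm G' D' A with
  | Var _ _ x => fun s q => ssub_none q (s _ x)
  | Star _ => fun _ q => ssub_none q Star
  | Pair _ _ _ t u => fun s q =>
      ssub_none q (Pair (sub t s SNil) (sub u s SNil))
  | Fst _ _ _ t => fun s q => ssub_none q (Fst (sub t s SNil))
  | Snd _ _ _ t => fun s q => ssub_none q (Snd (sub t s SNil))
  | Lam _ _ _ t => fun s q => ssub_none q (Lam (sub t (sup s) SNil))
  | App _ _ _ t u => fun s q =>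
      ssub_none q (App (sub t s SNil) (sub u s SNil))
  | SVar _ _ => fun _ q => ssub_some q
  | CStar _ _ => fun _ _ => CStar
  | CPair _ _ _ _ t u => fun s q => CPair (sub t s q) (sub u s q)
  | CFst _ _ _ _ t => fun s q => CFst (sub t s q)
  | CSnd _ _ _ _ t => fun s q => CSnd (sub t s q)
  | CLam _ _ A _ t => fun s q => CLam (sub t (sup s) (ssub_wk A q))
  | CApp _ _ _ _ t u => fun s q => CApp (sub t s q) (sub u s SNil)
  | Top _ => fun _ q => ssub_none q Top
  | LetTop _ _ _ t u => fun s q => LetTop (sub t s q) (sub u s SNil)
  | Bang _ _ t => fun s q => ssub_none q (Bang (sub t s SNil))
  | LetBang _ _ _ _ t u => fun s q =>
      LetBang (sub t s q) (sub u (sup s) SNil)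
  | Tens _ _ _ _ t u => fun s q => Tens (sub t s SNil) (sub u s q)
  | LetTens _ _ _ _ _ t u => fun s q =>
      LetTens (sub t s q) (sub u (sup s) (SOne SVar))
  | Abort _ _ A t => fun s q => Abort A (sub t s q)
  | Inl _ _ _ B t => fun s q => Inl B (sub t s q)
  | Inr _ _ A _ t => fun s q => Inr A (sub t s q)
  | Case _ _ _ _ _ t u v => fun s q =>
      Case (sub t s q) (sub u s (SOne SVar)) (sub v s (SOne SVar))
  | LLam _ _ _ t => fun s q => ssub_none q (LLam (sub t s (SOne SVar)))
  | LApp _ _ _ _ t u => fun s q => LApp (sub t s SNil) (sub u s q)
  end s q.

Definition ssub_id (G : ctx) (D : stoup) : ssub G D D :=
  match D with
  | None => SNil
  | Some _ => SOne SVar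
  end.

(* t[u/x] for the last variable x of the context *)
Definition vsub (G : ctx) (D : stoup) (A B : vtype) (t : tm (A :: G) D B)
    (u : tm G None A) : tm G D B :=
  sub t (scons u (@idsub G)) (ssub_id G D).

(* t[u/z] for the stoup variable z *)
Definition lsub (G : ctx) (D : stoup) (A : ctype) (B : vtype)
    (t : tm G (Some A) B) (u : tm G D A) : tm G D B :=
  sub t (@idsub G) (SOne u).

(* t[u/x, v/z] *)
Definition vlsub (G : ctx) (D : stoup) (A : vtype) (B : ctype) (C : vtype)
    (t : tm (A :: G) (Some B) C) (u : tm G None A) (v : tm G D B) : tm G D C :=
  sub t (scons u (@idsub G)) (SOne v).

(* [eqtm t u] is the judgement G | D |- t = u : A. *)
Inductive eqtm : forall (G : ctx) (D : stoup) (A : vtype),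
    tm G D A -> tm G D A -> Prop :=
| eqtm_refl G D A (t : tm G D A) : eqtm t t
| eqtm_sym G D A (t u : tm G D A) : eqtm t u -> eqtm u t
| eqtm_trans G D A (t u v : tm G D A) : eqtm t u -> eqtm u v -> eqtm t v
| eqtm_Pair G A B (t t' : tm G None A) (u u' : tm G None B) :
    eqtm t t' -> eqtm u u' -> eqtm (Pair t u) (Pair t' u')
| eqtm_Fst G A B (t t' : tm G None (VProd A B)) :
    eqtm t t' -> eqtm (Fst t) (Fst t')
| eqtm_Snd G A B (t t' : tm G None (VProd A B)) :
    eqtm t t' -> eqtm (Snd t) (Snd t')
| eqtm_Lam G A B (t t' : tm (A :: G) None B) :
    eqtm t t' -> eqtm (Lam t) (Lam t')
| eqtm_App G A B (t t' : tm G None (VArr A B)) (u u' : tm G None A) :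
    eqtm t t' -> eqtm u u' -> eqtm (App t u) (App t' u')
| eqtm_CPair G D (A B : ctype) (t t' : tm G D A) (u u' : tm G D B) :
    eqtm t t' -> eqtm u u' -> eqtm (CPair t u) (CPair t' u')
| eqtm_CFst G D (A B : ctype) (t t' : tm G D (CWith A B)) :
    eqtm t t' -> eqtm (CFst t) (CFst t')
| eqtm_CSnd G D (A B : ctype) (t t' : tm G D (CWith A B)) :
    eqtm t t' -> eqtm (CSnd t) (CSnd t')
| eqtm_CLam G D A (B : ctype) (t t' : tm (A :: G) D B) :
    eqtm t t' -> eqtm (CLam t) (CLam t')
| eqtm_CApp G D A B (t t' : tm G D (CArr A B)) (u u' : tm G None A) :
    eqtm t t' -> eqtm u u' -> eqtm (CApp t u) (CApp t' u')
| eqtm_LetTop G D (A : ctype) (t t' : tm G D CI) (u u' : tm G None A) :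
    eqtm t t' -> eqtm u u' -> eqtm (LetTop t u) (LetTop t' u')
| eqtm_Bang G A (t t' : tm G None A) : eqtm t t' -> eqtm (Bang t) (Bang t')
| eqtm_LetBang G D A (B : ctype) (t t' : tm G D (CBang A))
      (u u' : tm (A :: G) None B) :
    eqtm t t' -> eqtm u u' -> eqtm (LetBang t u) (LetBang t' u')
| eqtm_Tens G D A (B : ctype) (t t' : tm G None A) (u u' : tm G D B) :
    eqtm t t' -> eqtm u u' -> eqtm (Tens t u) (Tens t' u')
| eqtm_LetTens G D A B (C : ctype) (t t' : tm G D (CTens A B))
      (u u' : tm (A :: G) (Some B) C) :
    eqtm t t' -> eqtm u u' -> eqtm (LetTens t u) (LetTens t' u')
| eqtm_Abort G D A (t t' : tm G D CZero) :
    eqtm t t' -> eqtm (Abort A t) (Abort A t')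
| eqtm_Inl G D (A B : ctype) (t t' : tm G D A) :
    eqtm t t' -> eqtm (Inl B t) (Inl B t')
| eqtm_Inr G D (A B : ctype) (t t' : tm G D B) :
    eqtm t t' -> eqtm (Inr A t) (Inr A t')
| eqtm_Case G D A B (C : ctype) (s s' : tm G D (CPlus A B))
      (t t' : tm G (Some A) C) (u u' : tm G (Some B) C) :
    eqtm s s' -> eqtm t t' -> eqtm u u' -> eqtm (Case s t u) (Case s' t' u')
| eqtm_LLam G (A B : ctype) (t t' : tm G (Some A) B) :
    eqtm t t' -> eqtm (LLam t) (LLam t')
| eqtm_LApp G D (A B : ctype) (s s' : tm G None (VLolli A B)) (t t' : tm G D A) :
    eqtm s s' -> eqtm t t' -> eqtm (LApp s t) (LApp s' t')
| eta_One G (t : tm G None VOne) : eqtm t Star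
| beta_Fst G A B (t : tm G None A) (u : tm G None B) : eqtm (Fst (Pair t u)) t
| beta_Snd G A B (t : tm G None A) (u : tm G None B) : eqtm (Snd (Pair t u)) u
| eta_Prod G A B (t : tm G None (VProd A B)) :
    eqtm (Pair (Fst t) (Snd t)) t
| beta_Arr G A B (t : tm (A :: G) None B) (u : tm G None A) :
    eqtm (App (Lam t) u) (vsub t u)
| eta_Arr G A B (t : tm G None (VArr A B)) :
    eqtm (Lam (App (wk A t) (Var VZ))) t
| eta_COne G D (t : tm G D COne) : eqtm t CStar
| beta_CFst G D (A B : ctype) (t : tm G D A) (u : tm G D B) :
    eqtm (CFst (CPair t u)) t
| beta_CSnd G D (A B : ctype) (t : tm G D A) (u : tm G D B) :
    eqtm (CSnd (CPair t u)) u
| eta_With G D (A B : ctype) (t : tm G D (CWith A B)) :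
    eqtm (CPair (CFst t) (CSnd t)) t
| beta_CArr G D A (B : ctype) (t : tm (A :: G) D B) (u : tm G None A) :
    eqtm (CApp (CLam t) u) (vsub t u)
| eta_CArr G D A B (t : tm G D (CArr A B)) :
    eqtm (CLam (CApp (wk A t) (Var VZ))) t
| beta_I G (A : ctype) (t : tm G None A) : eqtm (LetTop Top t) t
| eta_I G D (A : ctype) (t : tm G D CI) (u : tm G (Some CI) A) :
    eqtm (LetTop t (lsub u Top)) (lsub u t)
| beta_Bang G A (B : ctype) (t : tm G None A) (u : tm (A :: G) None B) :
    eqtm (LetBang (Bang t) u) (vsub u t)
| eta_Bang G D A (B : ctype) (t : tm G D (CBang A))
      (u : tm G (Some (CBang A)) B) :
    eqtm (LetBang t (lsub (wk A u) (Bang (Var VZ)))) (lsub u t)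
| beta_Tens G D A B (C : ctype) (t : tm G None A) (s : tm G D (VComp B))
      (u : tm (A :: G) (Some B) C) :
    eqtm (LetTens (Tens t s) u) (vlsub u t s)
| eta_Tens G D A B (C : ctype) (t : tm G D (CTens A B))
      (u : tm G (Some (CTens A B)) C) :
    eqtm (LetTens t (lsub (wk A u) (Tens (Var VZ) SVar))) (lsub u t)
| eta_Zero G D (A : ctype) (t : tm G D CZero) (u : tm G (Some CZero) A) :
    eqtm (Abort A t) (lsub u t)
| beta_Inl G D (A B C : ctype) (t : tm G D A) (u : tm G (Some A) C)
      (u' : tm G (Some B) C) :
    eqtm (Case (Inl B t) u u') (lsub u t)
| beta_Inr G D (A B C : ctype) (t : tm G D B) (u : tm G (Some A) C)
      (u' : tm G (Some B) C) :
    eqtm (Case (Inr A t) u u') (lsub u' t)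
| eta_Plus G D (A B C : ctype) (t : tm G D (CPlus A B))
      (u : tm G (Some (CPlus A B)) C) :
    eqtm (Case t (lsub u (Inl B SVar)) (lsub u (Inr A SVar))) (lsub u t)
| beta_Lolli G D (A B : ctype) (t : tm G (Some A) B) (u : tm G D A) :
    eqtm (LApp (LLam t) u) (lsub t u)
| eta_Lolli G (A B : ctype) (t : tm G None (VLolli A B)) :
    eqtm (LLam (LApp t SVar)) t.

Variable R : ctype.

Fixpoint vtr (A : vtype) : vtype :=
  match A with
  | VConst a => VConst a
  | VOne => VOne
  | VProd A B => VProd (vtr A) (vtr B)
  | VArr A B => VArr (vtr A) (vtr B)
  | VComp A => VLolli (ctr A) R
  | VLolli A B => VLolli (ctr B) (ctr A)
  end
with ctr (A : ctype) : ctype :=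
  match A with
  | CConst a =>
      match R with
      | CConst r => if a == r then CI else CConst a
      | _ => CConst a
      end
  | COne => CZero
  | CWith A B => CPlus (ctr A) (ctr B)
  | CArr A B => CTens (vtr A) (ctr B)
  | CI => R
  | CBang A => CArr (vtr A) R
  | CTens A B => CArr (vtr A) (ctr B)
  | CZero => COne
  | CPlus A B => CWith (ctr A) (ctr B)
  end.

Definition ctxtr (G : ctx) : ctx := map vtr G.

Fixpoint vartr (G : ctx) (A : vtype) (x : var G A) : var (ctxtr G) (vtr A) :=
  match x in var G A return var (ctxtr G) (vtr A) with
  | VZ _ _ => VZ
  | VS _ _ B y => VS (vtr B) (vartr y)
  end.

(* The type of the translation of a term of type [tm G D A]: covariant if the
   stoup is empty, contravariant in stoup and result otherwise.  The [unit]
   case is never reached, as a term with non-empty stoup has a computation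
   type. *)
Definition trty (G : ctx) (D : stoup) (A : vtype) : Type :=
  match D with
  | None => tm (ctxtr G) None (vtr A)
  | Some D =>
      match A with
      | VComp B => tm (ctxtr G) (Some (ctr B)) (ctr D)
      | _ => unit
      end
  end.

(* Where a rule allows an arbitrary stoup, the [None] branch is the clause for
   the value translation and the [Some] branch that for the computation
   translation.  [SVar] is k in the former and k_z in the latter; replacing one
   stoup variable by another, as in t[k/k_z], is the identity. *)
Fixpoint tr (G : ctx) (D : stoup) (A : vtype) (t : tm G D A) : trty G D A :=
  match t in tm G D A return trty G D A with
  | Var _ _ x => Var (vartr x)
  | Star _ => Star
  | Pair _ _ _ t u => Pair (tr t) (tr u)
  | Fst _ _ _ t => Fst (tr t)
  | Snd _ _ _ t => Snd (tr t)
  | Lam _ _ _ t => Lam (tr t)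
  | App _ _ _ t u => App (tr t) (tr u)
  | SVar _ _ => SVar
  | CStar G D =>
      match D return trty G D COne with
      | None => LLam (Abort R SVar)
      | Some D => Abort (ctr D) SVar
      end
  | CPair G D A B t u =>
      match D return trty G D A -> trty G D B -> trty G D (CWith A B) with
      | None => fun t u => LLam (Case SVar (LApp t SVar) (LApp u SVar))
      | Some _ => fun t u => Case SVar t u
      end (tr t) (tr u)
  | CFst G D A B t =>
      match D return trty G D (CWith A B) -> trty G D A with
      | None => fun t => LLam (LApp t (Inl (ctr B) SVar))
      | Some _ => fun t => lsub t (Inl (ctr B) SVar)
      end (tr t)
  | CSnd G D A B t =>
      match D return trty G D (CWith A B) -> trty G D B with
      | None => fun t => LLam (LApp t (Inr (ctr A) SVar))
      | Some _ => fun t => lsub t (Inr (ctr A) SVar)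
      end (tr t)
  | CLam G D A B t =>
      match D return trty (A :: G) D B -> trty G D (CArr A B) with
      | None => fun t => LLam (LetTens SVar (LApp t SVar))
      | Some _ => fun t => LetTens SVar t
      end (tr t)
  | CApp G D A B s t =>
      match D return trty G D (CArr A B) -> trty G None A -> trty G D B with
      | None => fun s t => LLam (LApp s (Tens t SVar))
      | Some _ => fun s t => lsub s (Tens t SVar)
      end (tr s) (tr t)
  | Top _ => LLam SVar
  | LetTop G D A t u =>
      match D return trty G D CI -> trty G None A -> trty G D A with
      | None => fun t u => LLam (LApp t (LApp u SVar))
      | Some _ => fun t u => lsub t (LApp u SVar)
      end (tr t) (tr u)
  | Bang _ _ t => LLam (CApp SVar (tr t))
  | LetBang G D A B t u =>
      match D return trty G D (CBang A) -> trty (A :: G) None B -> trty G D B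
      with
      | None => fun t u => LLam (LApp t (CLam (LApp u SVar)))
      | Some _ => fun t u => lsub t (CLam (LApp u SVar))
      end (tr t) (tr u)
  | Tens G D A B t u =>
      match D return trty G None A -> trty G D B -> trty G D (CTens A B) with
      | None => fun t u => LLam (LApp u (CApp SVar t))
      | Some _ => fun t u => lsub u (CApp SVar t)
      end (tr t) (tr u)
  | LetTens G D A B C s t =>
      match D return
        trty G D (CTens A B) -> trty (A :: G) (Some B) C -> trty G D C with
      | None => fun s t => LLam (LApp s (CLam t))
      | Some _ => fun s t => lsub s (CLam t)
      end (tr s) (tr t)
  | Abort G D A t =>
      match D return trty G D CZero -> trty G D A with
      | None => fun t => LLam (LApp t CStar)
      | Some _ => fun t => lsub t CStar
      end (tr t)
  | Inl G D A B t =>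
      match D return trty G D A -> trty G D (CPlus A B) with
      | None => fun t => LLam (LApp t (CFst SVar))
      | Some _ => fun t => lsub t (CFst SVar)
      end (tr t)
  | Inr G D A B t =>
      match D return trty G D B -> trty G D (CPlus A B) with
      | None => fun t => LLam (LApp t (CSnd SVar))
      | Some _ => fun t => lsub t (CSnd SVar)
      end (tr t)
  | Case G D A B C s t u =>
      match D return
        trty G D (CPlus A B) -> trty G (Some A) C -> trty G (Some B) C ->
        trty G D C with
      | None => fun s t u => LLam (LApp s (CPair t u))
      | Some _ => fun s t u => lsub s (CPair t u)
      end (tr s) (tr t) (tr u)
  | LLam _ _ _ t => LLam (tr t)
  | LApp G D A B s t =>
      match D return trty G None (VLolli A B) -> trty G D A -> trty G D B with
      | None => fun s t => LLam (LApp t (LApp s SVar))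
      | Some _ => fun s t => lsub t (LApp s SVar)
      end (tr s) (tr t)
  end.

Definition vtrans (G : ctx) (A : vtype) (t : tm G None A) :
    tm (ctxtr G) None (vtr A) := tr t.

Definition ctrans (G : ctx) (A B : ctype) (t : tm G (Some A) B) :
    tm (ctxtr G) (Some (ctr B)) (ctr A) := tr t.

End EEC.

Arguments VConst {V K}.
Arguments VOne {V K}.
Arguments CConst {V K}.
Arguments COne {V K}.
Arguments CI {V K}.
Arguments CZero {V K}.
Arguments VZ {V K G A}.
Arguments VS {V K G A} B.
Arguments Star {V K G}.
Arguments SVar {V K G A}.
Arguments CStar {V K G D}.
Arguments Top {V K G}.
Arguments Abort {V K G D} A.
Arguments Inl {V K G D A} B.
Arguments Inr {V K G D} A {B}.
Arguments SNil {V K G}.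

(* Main.v *)
From Stdlib Require Import FunctionalExtensionality Setoid Morphisms.
Require Import Defs.
From mathcomp Require Import all_boot.

(** Because R is a constant or I, we have R° = I and I° = R, and the translation
    is an involution up to isomorphism: by induction on types there are
    invertible closed terms A -> A•• and A ⊸ A°°, which are not mere congruences
    only because A°° ≅ (I ⊸ A°°) and !A ≅ (!A ⊗ I).  The translation is sound
    for equality, and the isomorphisms are natural: t•• is t conjugated by them.
    Faithfulness follows at once.  For fullness, translate the given term t once
    more and conjugate back by the isomorphisms; the resulting u satisfies
    u•• = t•, hence u• = t by faithfulness. *)

Set Implicit Arguments.
Unset Strict Implicit.
Unset Printing Implicit Defensive.

(** Every rule with an arbitrary stoup has two clauses, a covariant and a contravariant one. To
    treat them once, a computation term with empty stoup is read as the linear term k |-> t•{k}: the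
    empty stoup then counts as I, with translation R. Under this reading ([trc]) stoup substitution
    becomes composition in the reverse order, and the double translation ([ttc]) carries each term
    former to itself, except those of I and !, where a stoup of type R° replaces the empty one. This
    is why the isomorphism A•• → A at a computation type A evaluates at the unit of R° ≅ I. Terms
    are intrinsically typed and [R] is a variable, so R° = I and α°° = α are only propositional;
    they enter terms through explicit coercions [castL]. Fullness needs one more fact than
    naturality: precomposition with the isomorphisms of context and stoup is injective. It turns an
    equation between terms over Γ into the required equation over Γ••. *)

Ltac rewrite_IH := repeat match goal with
  | H : forall _, _ |- _ => rewrite {}H
  | H : _ = _ |- _ => rewrite {}H
  end.

(** * Substitution *)

Section Syntax.

Variables (V : Type) (K : eqType).
Implicit Types (G : ctx V K) (D : stoup V K).

Lemma var_nil_elim (T : Type) (A : vtype V K) (x : var [::] A) : T.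
Proof.
exact: (match x in var H _ return match H with [::] => T | _ => unit end with
  | VZ _ _ => tt | VS _ _ _ _ => tt end).
Defined.

(** The return clause recomputes the motive from the context index. No equality between types has to
    be inverted, which matters because [V] is an arbitrary type without decidable equality. *)
Lemma var_cons_ind G B (P : forall A, var (B :: G) A -> Prop) :
  P B VZ -> (forall A (x : var G A), P A (VS B x)) -> forall A x, P A x.
Proof.
move=> hZ hS A x; move: P hZ hS.
exact: (match x in var H A return
  match H return var H A -> Prop with
  | [::] => fun=> True
  | C :: H' => fun x => forall P : forall A, var (C :: H') A -> Prop,
      P C VZ -> (forall A (y : var H' A), P A (VS C y)) -> P A x
  end x with
  | VZ _ _ => fun P hZ _ => hZ
  | VS _ _ _ y => fun P _ hS => hS _ y
  end).
Qed.

(** Functional extensionality makes pointwise equal substitutions equal, so the substitution lemmas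
    are plain equations and can be used for rewriting. *)
Lemma subst_ext G G' (s s' : subst G G') :
  (forall A (x : var G A), s A x = s' A x) -> s = s'.
Proof.
move=> h; apply: functional_extensionality_dep => A.
exact: functional_extensionality.
Qed.

Lemma subst_ext_cons G G' B (s s' : subst (B :: G) G') :
  s B VZ = s' B VZ ->
  (forall A (x : var G A), s A (VS B x) = s' A (VS B x)) -> s = s'.
Proof. by move=> hZ hS; apply: subst_ext; apply: var_cons_ind. Qed.

Lemma rename_ext G G' (r r' : rename G G') :
  (forall A (x : var G A), r A x = r' A x) -> r = r'.
Proof.
move=> h; apply: functional_extensionality_dep => A.
exact: functional_extensionality.
Qed.

Lemma ssub_None_ind G (P : forall D, ssub G None D -> Prop) :
  P None SNil -> forall D q, P D q.
Proof.
move=> h D q.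
exact: (match q in ssub _ E D return
  match E return ssub G E D -> Prop with
  | None => fun q => P D q
  | Some _ => fun=> True
  end q with
  | SNil => h
  | SOne _ _ _ => I
  end).
Qed.

Lemma ssub_Some_ind G A (P : forall D, ssub G (Some A) D -> Prop) :
  (forall D (u : tm G D (VComp A)), P D (SOne u)) -> forall D q, P D q.
Proof.
move=> h D q; move: P h.
exact: (match q in ssub _ E D return
  match E return ssub G E D -> Prop with
  | None => fun=> True
  | Some A => fun q => forall P : forall D, ssub G (Some A) D -> Prop,
      (forall D (u : tm G D (VComp A)), P D (SOne u)) -> P D q
  end q with
  | SNil => I
  | SOne _ _ u => fun P h => h _ u
  end).
Qed.

Lemma ssub_wk_id G D B : ssub_wk B (ssub_id G D) = ssub_id (B :: G) D.
Proof. by case: D. Qed.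

Lemma sup_Var G G' B (r : rename G G') :
  sup (B := B) (fun A x => Var (r A x)) = fun A x => Var (rup r x).
Proof. exact: subst_ext_cons. Qed.

(** Gives every mixture of renamings and substitutions the single normal form [sub t s q], on which
    [syn] relies. *)
Lemma renE G D A (t : tm G D A) G' (r : rename G G') :
  ren t r = sub t (fun A x => Var (r A x)) (ssub_id _ _).
Proof.
elim: t G' r => //=; intros; rewrite ?sup_Var ?ssub_wk_id; rewrite_IH => //=.
Qed.

Lemma sup_rup (H H' H2 : ctx V K) B (s : subst H' H2) (r : rename H H') :
  (fun A x => sup (B := B) s (rup r x)) = sup (fun A x => s A (r A x)).
Proof. exact: (@subst_ext_cons H (B :: H2) B). Qed.

Lemma sub_ren G D A (t : tm G D A) G' (r : rename G G') G2 D2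
    (s : subst G' G2) (q : ssub G2 D D2) :
  sub (ren t r) s q = sub t (fun A x => s A (r A x)) q.
Proof.
elim: t G' r G2 D2 s q => //=; intros; rewrite_IH; rewrite ?sup_rup //.
Qed.

Lemma ren_ren G D A (t : tm G D A) G' (r : rename G G') G2 (r' : rename G' G2) :
  ren (ren t r) r' = ren t (fun A x => r' A (r A x)).
Proof. by rewrite renE sub_ren renE. Qed.

Definition ssub_ren G G' (r : rename G G') D D' (q : ssub G D D') :
    ssub G' D D' :=
  match q with
  | SNil => SNil
  | SOne _ _ u => SOne (ren u r)
  end.

Lemma ren_ssub_none G G' (r : rename G G') D A (q : ssub G None D)
    (t : tm G None A) :
  ren (ssub_none q t) r = ssub_none (ssub_ren r q) (ren t r).
Proof. by elim/ssub_None_ind: D / q. Qed.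

Lemma ren_ssub_some G G' (r : rename G G') D A (q : ssub G (Some A) D) :
  ren (ssub_some q) r = ssub_some (ssub_ren r q).
Proof. by elim/ssub_Some_ind: D / q. Qed.

Lemma ssub_ren_wk G G' B (r : rename G G') D D' (q : ssub G D D') :
  ssub_ren (rup r) (ssub_wk B q) = ssub_wk B (ssub_ren r q).
Proof. by case: q => //= *; rewrite /wk !ren_ren. Qed.

Lemma ren_sup (H H' H2 : ctx V K) B (s : subst H H') (r : rename H' H2) :
  (fun A x => ren (sup (B := B) s x) (rup r)) = sup (fun A x => ren (s A x) r).
Proof.
by apply: (@subst_ext_cons H (B :: H2) B) => //= *; rewrite /wk !ren_ren.
Qed.

Lemma ren_sub G D A (t : tm G D A) G' D' (s : subst G G') (q : ssub G' D D')
    G2 (r : rename G' G2) :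
  ren (sub t s q) r = sub t (fun A x => ren (s A x) r) (ssub_ren r q).
Proof.
elim: t G' D' s q G2 r => //=; intros;
  rewrite ?ren_ssub_none ?ren_ssub_some //=; rewrite_IH;
  rewrite ?ssub_ren_wk ?ren_sup //.
Qed.

Definition ssub_comp G G' (s : subst G G') D D' D2 (q : ssub G D D') :
    ssub G' D' D2 -> ssub G' D D2 :=
  match q with
  | SNil => id
  | SOne _ _ u => fun q' => SOne (sub u s q')
  end.

Lemma sub_ssub_none G G' (s : subst G G') D D' A (q : ssub G None D)
    (q' : ssub G' D D') (t : tm G None A) :
  sub (ssub_none q t) s q' = ssub_none (ssub_comp s q q') (sub t s SNil).
Proof.
by elim/ssub_None_ind: D / q q' => q'; elim/ssub_None_ind: D' / q'.
Qed.

Lemma sub_ssub_some G G' (s : subst G G') D D' A (q : ssub G (Some A) D)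
    (q' : ssub G' D D') :
  sub (ssub_some q) s q' = ssub_some (ssub_comp s q q').
Proof. by elim/ssub_Some_ind: D / q q'. Qed.

Lemma ssub_comp_wk G G' B (s : subst G G') D D' D2 (q : ssub G D D')
    (q' : ssub G' D' D2) :
  ssub_comp (sup s) (ssub_wk B q) (ssub_wk B q') = ssub_wk B (ssub_comp s q q').
Proof. by case: q q' => //= *; rewrite /wk sub_ren ren_sub. Qed.

Lemma sub_sup (H H' H2 : ctx V K) B (s : subst H H') (s' : subst H' H2) :
  (fun A x => sub (sup (B := B) s x) (sup s') SNil) =
  sup (fun A x => sub (s A x) s' SNil).
Proof.
apply: (@subst_ext_cons H (B :: H2) B) => //= *.
by rewrite /wk sub_ren ren_sub.
Qed.

(** Under a binder the fused substitution has to commute with weakening. Hence the mixed laws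
    [sub_ren] and [ren_sub] come before this one. *)
Lemma sub_sub G D A (t : tm G D A) G' D' (s : subst G G') (q : ssub G' D D')
    G2 D2 (s' : subst G' G2) (q' : ssub G2 D' D2) :
  sub (sub t s q) s' q' =
  sub t (fun A x => sub (s A x) s' SNil) (ssub_comp s' q q').
Proof.
elim: t G' D' s q G2 D2 s' q' => //=; intros;
  rewrite ?sub_ssub_none ?sub_ssub_some //=; rewrite_IH;
  rewrite ?ssub_comp_wk ?sub_sup //.
Qed.

Lemma sup_id G B : sup (B := B) (@idsub V K G) = @idsub V K (B :: G).
Proof. exact: subst_ext_cons. Qed.

Lemma sub_id G D A (t : tm G D A) : sub t (@idsub V K G) (ssub_id G D) = t.
Proof.
elim: t => //=; intros; simpl in *; rewrite ?sup_id ?ssub_wk_id;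
  rewrite_IH => //=.
Qed.

End Syntax.

Lemma sub_ext V K G D (A : vtype V K) (t : tm G D A) G' D'
    (s s' : subst G G') (q q' : ssub G' D D') :
  s = s' -> q = q' -> sub t s q = sub t s' q'.
Proof. by move=> -> ->. Qed.

(* Proves equations between substitution instances: both sides are brought to
   the form [sub t s q] and compared variable by variable. *)
Ltac syn := simpl; rewrite /wk /lsub /vsub /vlsub ?renE ?sub_sub /idsub /=;
  first [reflexivity|
  match goal with
  | |- sub ?t _ _ = sub ?t _ _ => apply: sub_ext;
      [first [apply: subst_ext_cons; [syn|intros; syn]
             | apply: subst_ext; intros; syn]
      | syn]
  | |- sub ?t _ _ = ?t => etransitivity; [|apply: sub_id]; syn
  | |- ?t = sub ?t _ _ => symmetry; syn
  | |- _ = _ => progress f_equal; syn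
  | x : var (_ :: _) _ |- _ => elim/var_cons_ind: x; intros; syn
  end].

(** * Congruence and commuting conversions *)

Section Congruence.

Variables (V : Type) (K : eqType).
Implicit Types (G : ctx V K) (D : stoup V K).

#[export] Instance eqtm_Equivalence G D A : Equivalence (@eqtm V K G D A).
Proof.
split; [exact: eqtm_refl|exact: eqtm_sym|exact: eqtm_trans].
Qed.

Lemma eqtm_eq G D A (t u : tm G D A) : t = u -> eqtm t u.
Proof. by move=> ->; reflexivity. Qed.

Lemma eqtm_eqlr G D A (t t' u u' : tm G D A) :
  t = t' -> eqtm t' u' -> u' = u -> eqtm t u.
Proof. by move=> -> h <-. Qed.

Ltac cases_ssub := repeat match goal with
  | q : ssub _ None _ |- _ => elim/ssub_None_ind: q; intros
  | q : ssub _ (Some _) _ |- _ => elim/ssub_Some_ind: q; intros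
  | q : ssub _ ?D _ |- _ => is_var D; destruct D
  | D : stoup _ _ |- _ => destruct D
  end.

Ltac by_axiom ax := etransitivity; [apply: ax|];
  apply: eqtm_eq; cases_ssub; syn.

(** Each axiom is closed under substitution: the instance of the axiom at the substituted terms
    differs from the goal only by a substitution identity, left to [syn]. *)
Lemma eqtm_sub G D A (t t' : tm G D A) G' D' (s : subst G G')
    (q : ssub G' D D') :
  eqtm t t' -> eqtm (sub t s q) (sub t' s q).
Proof.
move=> h; elim: h G' D' s q => {G D A t t'}; intros.
all: try by constructor; auto.
all: try by cases_ssub; constructor; auto.
all: try by etransitivity; eauto.
all: try by symmetry; auto.
all: simpl.
- by cases_ssub; by_axiom beta_Arr.
- cases_ssub; (etransitivity; [|apply: eta_Arr]); apply: eqtm_eq; syn.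
- by_axiom beta_CArr.
- etransitivity; [|apply: eta_CArr]; apply: eqtm_eq; cases_ssub; syn.
(* In the eta rules for I, !, ⊗, 0 and ⊕ the stoup variable of [u] is bound by the rule, so [q] acts
   on [t] only. The instance therefore keeps the stoup of [u] and is given by hand, as unification
   cannot invert [lsub]. *)
- apply: (eqtm_eqlr _ (eta_I _ (sub u s (SOne SVar)))); cases_ssub; syn.
- by cases_ssub; simpl; by_axiom beta_Bang.
- apply: (eqtm_eqlr _ (eta_Bang _ (sub u s (SOne SVar)))); cases_ssub; syn.
- by_axiom beta_Tens.
- apply: (eqtm_eqlr _ (eta_Tens _ (sub u s (SOne SVar)))); cases_ssub; syn.
- etransitivity;
    [apply: (eta_Zero _ (sub u s (SOne SVar)))|]; apply: eqtm_eq; cases_ssub;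
    syn.
- by_axiom beta_Inl.
- by_axiom beta_Inr.
- apply: (eqtm_eqlr _ (eta_Plus _ (sub u s (SOne SVar)))); cases_ssub; syn.
- by_axiom beta_Lolli.
Qed.

(** With an empty stoup there is nothing to compare, [SNil] being the only inhabitant. *)
Definition eqssub G D D' : ssub G D D' -> ssub G D D' -> Prop :=
  match D with
  | None => fun _ _ => True
  | Some _ => fun q q' => eqtm (ssub_some q) (ssub_some q')
  end.

Lemma eqssub_refl G D D' (q : ssub G D D') : eqssub q q.
Proof. by case: D q => //= *; reflexivity. Qed.

Lemma eqtm_wk G D A B (t t' : tm G D A) : eqtm t t' -> eqtm (wk B t) (wk B t').
Proof. by rewrite /wk !renE; apply: eqtm_sub. Qed.

Lemma eqssub_wk G D D' B (q q' : ssub G D D') :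
  eqssub q q' -> eqssub (ssub_wk B q) (ssub_wk B q').
Proof.
have wk_some (A : ctype V K) (p : ssub G (Some A) D') :
    ssub_some (ssub_wk B p) = wk B (ssub_some p).
  by elim/ssub_Some_ind: D' / p q q'.
by case: D q q' => //= A q q'; rewrite !wk_some; apply: eqtm_wk.
Qed.

Lemma ssub_none_SNil G A (q : ssub G None None) (t : tm G None A) :
  ssub_none q t = t.
Proof.
(* Both stoup indices are concrete here, so the motive is first extended to all target stoups. *)
pose P D := match D return ssub G None D -> Prop with
  | None => fun q => ssub_none q t = t
  | Some _ => fun=> True
  end.
exact: (@ssub_None_ind V K G P erefl None q).
Qed.

Lemma eqtm_ssub_none G D A (q q' : ssub G None D) (t t' : tm G None A) :
  eqtm t t' -> eqtm (ssub_none q t) (ssub_none q' t').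
Proof.
by elim/ssub_None_ind: D / q q' => q'; rewrite !ssub_none_SNil.
Qed.

Lemma eqtm_sup G G' B (s s' : subst G G') :
  (forall A (x : var G A), eqtm (s A x) (s' A x)) ->
  forall A (x : var (B :: G) A), eqtm (sup s x) (sup s' x).
Proof.
move=> h; apply: var_cons_ind => [|A x] /=; first by reflexivity.
exact: eqtm_wk.
Qed.

Lemma eqtm_subst G D A (t : tm G D A) G' D' (s s' : subst G G')
    (q q' : ssub G' D D') :
  (forall B (x : var G B), eqtm (s B x) (s' B x)) -> eqssub q q' ->
  eqtm (sub t s q) (sub t s' q').
Proof.
elim: t G' D' s s' q q' => /=; intros; try apply: eqtm_ssub_none;
  try (by constructor; auto using eqtm_sup, eqssub_wk, eqssub_refl, eqtm_refl).
all: done.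
Qed.

(** This instance and the ones below let [rewrite] apply equalities of the calculus inside terms. *)
#[export] Instance lsub_Proper G D (A : ctype V K) B :
  Proper (@eqtm V K G (Some A) B ==> @eqtm V K G D A ==> @eqtm V K G D B)
    (@lsub V K G D A B).
Proof.
move=> t t' ht u u' hu; rewrite /lsub; etransitivity; first exact: eqtm_sub ht.
by apply: eqtm_subst => // *; reflexivity.
Qed.

#[export] Instance vsub_Proper G D A B :
  Proper (@eqtm V K (A :: G) D B ==> @eqtm V K G None A ==> @eqtm V K G D B)
    (@vsub V K G D A B).
Proof.
move=> t t' ht u u' hu; rewrite /vsub; etransitivity; first exact: eqtm_sub ht.
apply: eqtm_subst; last exact: eqssub_refl.
by apply: var_cons_ind => //= *; reflexivity.
Qed.

#[export] Instance wk_Proper G D A B :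
  Proper (@eqtm V K G D A ==> @eqtm V K (B :: G) D A) (@wk V K G D A B).
Proof. by move=> *; apply: eqtm_wk. Qed.

Ltac proper := by repeat move=> ?; constructor.

#[export] Instance Pair_Proper G A B :
  Proper (@eqtm V K G None A ==> @eqtm V K G None B ==> @eqtm V K G None _)
    (@Pair V K G A B).
Proof. proper. Qed.

#[export] Instance Fst_Proper G A B :
  Proper (@eqtm V K G None _ ==> @eqtm V K G None A) (@Fst V K G A B).
Proof. proper. Qed.

#[export] Instance Snd_Proper G A B :
  Proper (@eqtm V K G None _ ==> @eqtm V K G None B) (@Snd V K G A B).
Proof. proper. Qed.

#[export] Instance Lam_Proper G A B :
  Proper (@eqtm V K (A :: G) None B ==> @eqtm V K G None _) (@Lam V K G A B).
Proof. proper. Qed.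

#[export] Instance App_Proper G A B :
  Proper (@eqtm V K G None _ ==> @eqtm V K G None A ==> @eqtm V K G None B)
    (@App V K G A B).
Proof. proper. Qed.

#[export] Instance CPair_Proper G D (A B : ctype V K) :
  Proper (@eqtm V K G D A ==> @eqtm V K G D B ==> @eqtm V K G D _)
    (@CPair V K G D A B).
Proof. proper. Qed.

#[export] Instance CFst_Proper G D (A B : ctype V K) :
  Proper (@eqtm V K G D _ ==> @eqtm V K G D A) (@CFst V K G D A B).
Proof. proper. Qed.

#[export] Instance CSnd_Proper G D (A B : ctype V K) :
  Proper (@eqtm V K G D _ ==> @eqtm V K G D B) (@CSnd V K G D A B).
Proof. proper. Qed.

#[export] Instance CLam_Proper G D A (B : ctype V K) :
  Proper (@eqtm V K (A :: G) D B ==> @eqtm V K G D _) (@CLam V K G D A B).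
Proof. proper. Qed.

#[export] Instance CApp_Proper G D A (B : ctype V K) :
  Proper (@eqtm V K G D _ ==> @eqtm V K G None A ==> @eqtm V K G D B)
    (@CApp V K G D A B).
Proof. proper. Qed.

#[export] Instance LetTop_Proper G D (A : ctype V K) :
  Proper (@eqtm V K G D _ ==> @eqtm V K G None A ==> @eqtm V K G D A)
    (@LetTop V K G D A).
Proof. proper. Qed.

#[export] Instance Bang_Proper G A :
  Proper (@eqtm V K G None A ==> @eqtm V K G None _) (@Bang V K G A).
Proof. proper. Qed.

#[export] Instance LetBang_Proper G D A (B : ctype V K) :
  Proper (@eqtm V K G D _ ==> @eqtm V K (A :: G) None B ==> @eqtm V K G D B)
    (@LetBang V K G D A B).
Proof. proper. Qed.

#[export] Instance Tens_Proper G D A (B : ctype V K) :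
  Proper (@eqtm V K G None A ==> @eqtm V K G D B ==> @eqtm V K G D _)
    (@Tens V K G D A B).
Proof. proper. Qed.

#[export] Instance LetTens_Proper G D A (B C : ctype V K) :
  Proper (@eqtm V K G D _ ==> @eqtm V K (A :: G) (Some B) C ==> @eqtm V K G D C)
    (@LetTens V K G D A B C).
Proof. proper. Qed.

#[export] Instance Abort_Proper G D (A : ctype V K) :
  Proper (@eqtm V K G D _ ==> @eqtm V K G D A) (@Abort V K G D A).
Proof. proper. Qed.

#[export] Instance Inl_Proper G D (A B : ctype V K) :
  Proper (@eqtm V K G D A ==> @eqtm V K G D _) (@Inl V K G D A B).
Proof. proper. Qed.

#[export] Instance Inr_Proper G D (A B : ctype V K) :
  Proper (@eqtm V K G D B ==> @eqtm V K G D _) (@Inr V K G D A B).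
Proof. proper. Qed.

#[export] Instance Case_Proper G D (A B C : ctype V K) :
  Proper (@eqtm V K G D _ ==> @eqtm V K G (Some A) C ==>
      @eqtm V K G (Some B) C ==> @eqtm V K G D C)
    (@Case V K G D A B C).
Proof. proper. Qed.

#[export] Instance LLam_Proper G (A B : ctype V K) :
  Proper (@eqtm V K G (Some A) B ==> @eqtm V K G None _) (@LLam V K G A B).
Proof. proper. Qed.

#[export] Instance LApp_Proper G D (A B : ctype V K) :
  Proper (@eqtm V K G None _ ==> @eqtm V K G D A ==> @eqtm V K G D B)
    (@LApp V K G D A B).
Proof. proper. Qed.

End Congruence.

#[global] Hint Resolve eqtm_refl : core.

Section Commuting.

Variables (V : Type) (K : eqType).
Implicit Types (G : ctx V K) (D : stoup V K) (A B C : ctype V K).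

Lemma lsub_SVarr G A B (t : tm G (Some A) (VComp B)) : lsub t SVar = t.
Proof. exact: sub_id. Qed.

Lemma lsub_lsub G D A B C (t : tm G (Some B) (VComp C))
    (u : tm G (Some A) (VComp B)) (v : tm G D (VComp A)) :
  lsub (lsub t u) v = lsub t (lsub u v).
Proof. syn. Qed.

(** Like the other commuting conversions below, this follows from an eta rule. Eta is applied to [v]
    with the eliminator at the stoup variable plugged in, and beta then simplifies the branches. *)
Lemma lsub_of_Case G D A B C C' (v : tm G (Some C) (VComp C'))
    (s : tm G D (VComp (CPlus A B))) (t : tm G (Some A) (VComp C)) u :
  eqtm (lsub v (Case s t u)) (Case s (lsub v t) (lsub v u)).
Proof.
symmetry; etransitivity; last first.
  apply: (eqtm_eqlr _ (eta_Plus s (lsub v (Case SVar t u)))); first reflexivity.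
  by syn.
apply: eqtm_Case; first reflexivity.
- rewrite lsub_lsub; apply: lsub_Proper; first reflexivity.
  by symmetry; apply: (eqtm_eqlr _ (beta_Inl SVar t u)); syn.
- rewrite lsub_lsub; apply: lsub_Proper; first reflexivity.
  by symmetry; apply: (eqtm_eqlr _ (beta_Inr SVar t u)); syn.
Qed.

Lemma lsub_of_LetTens G D X A C C' (v : tm G (Some C) (VComp C'))
    (s : tm G D (VComp (CTens X A))) (t : tm (X :: G) (Some A) (VComp C)) :
  eqtm (lsub v (LetTens s t)) (LetTens s (lsub (wk X v) t)).
Proof.
symmetry; etransitivity; last first.
  apply: (eqtm_eqlr _ (eta_Tens s (lsub v (LetTens SVar t))));
    first reflexivity.
  by syn.
apply: eqtm_LetTens; first reflexivity.
symmetry; etransitivity.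
  (* This is the body of the eta instance. Weakening has moved [t] below the new binder while
     keeping its own bound variable, hence the [sup]. *)
  apply: (@eqtm_eq _ _ _ _ _ _
    (lsub (wk X v) (LetTens (Tens (Var VZ) SVar)
      (sub t (sup (fun Y x => Var (VS X x))) (SOne SVar))))).
  by syn.
apply: lsub_Proper; first reflexivity.
by apply: (eqtm_eqlr erefl (beta_Tens _ _ _)); syn.
Qed.

Lemma lsub_of_LetBang G D X C C' (v : tm G (Some C) (VComp C'))
    (s : tm G D (VComp (CBang X))) (t : tm (X :: G) None (VComp C)) :
  eqtm (lsub v (LetBang s t)) (LetBang s (lsub (wk X v) t)).
Proof.
symmetry; etransitivity; last first.
  apply: (eqtm_eqlr _ (eta_Bang s (lsub v (LetBang SVar t))));
    first reflexivity.
  by syn.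
apply: eqtm_LetBang; first reflexivity.
symmetry; etransitivity.
  apply: (@eqtm_eq _ _ _ _ _ _
    (lsub (wk X v) (LetBang (Bang (Var VZ))
      (sub t (sup (fun Y x => Var (VS X x))) SNil)))).
  by syn.
apply: lsub_Proper; first reflexivity.
by apply: (eqtm_eqlr erefl (beta_Bang _ _)); syn.
Qed.

Lemma lsub_of_LetTop G D C C' (v : tm G (Some C) (VComp C'))
    (s : tm G D (VComp CI)) (t : tm G None (VComp C)) :
  eqtm (lsub v (LetTop s t)) (LetTop s (lsub v t)).
Proof.
symmetry; etransitivity; last first.
  apply: (eqtm_eqlr _ (eta_I s (lsub v (LetTop SVar t)))); first reflexivity.
  by syn.
apply: eqtm_LetTop; first reflexivity.
rewrite lsub_lsub; apply: lsub_Proper; first reflexivity.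
by symmetry; apply: (eqtm_eqlr _ (beta_I t)); syn.
Qed.

Lemma lsub_of_Abort G D C C' (v : tm G (Some C) (VComp C'))
    (s : tm G D (VComp CZero)) : eqtm (lsub v (Abort C s)) (Abort C' s).
Proof.
symmetry; apply: (eqtm_eqlr _ (eta_Zero s (lsub v (Abort C SVar)))) => //.
by syn.
Qed.

Lemma Lolli_ext G A B (t u : tm G None (VLolli A B)) :
  eqtm (LApp t SVar) (LApp u SVar) -> eqtm t u.
Proof. by move=> h; rewrite -(eta_Lolli t) -(eta_Lolli u) h. Qed.

End Commuting.

(** * Soundness of the translation *)

Section Translation.

Variables (V : Type) (K : eqType) (R : ctype V K).
Implicit Types (G : ctx V K) (D : stoup V K).

(** Every variable of [ctxtr R G] has the form [vartr R x]. Recursion on [G] yields an eliminator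
    into data from this, with no cast along type equalities; it serves to translate renamings and
    substitutions. *)
Fixpoint var_tr_rect G (T : vtype V K -> Type) :
    (forall A, var G A -> T (vtr R A)) -> forall B, var (ctxtr R G) B -> T B :=
  match G with
  | [::] => fun _ B x => var_nil_elim _ x
  | C :: G0 => fun f B x =>
      match x in var H B return
        match H with
        | [::] => unit
        | C' :: H' => T C' -> (forall B, var H' B -> T B) -> T B
        end with
      | VZ _ _ => fun z _ => z
      | VS _ _ _ y => fun _ s => s _ y
      end (f _ VZ) (var_tr_rect (fun A x => f A (VS C x)))
  end.

Lemma var_tr_rectE G (T : vtype V K -> Type)
    (f : forall A, var G A -> T (vtr R A)) A (x : var G A) :
  var_tr_rect f (vartr R x) = f A x.
Proof. by elim: x T f => //= *; rewrite_IH. Qed.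

Lemma var_tr_ind G (P : forall B, var (ctxtr R G) B -> Prop) :
  (forall A (x : var G A), P _ (vartr R x)) -> forall B x, P B x.
Proof.
elim: G P => [|C G IH] P h; first by move=> B x; apply: var_nil_elim x.
apply: (var_cons_ind (P := P)); first exact: (h _ VZ).
by apply: IH => A x; apply: (h _ (VS C x)).
Qed.

Definition rtr G G' (r : rename G G') : rename (ctxtr R G) (ctxtr R G') :=
  var_tr_rect (fun A x => vartr R (r A x)).

Definition str G G' (s : subst G G') : subst (ctxtr R G) (ctxtr R G') :=
  var_tr_rect (T := tm (ctxtr R G') None) (fun A x => tr R (s A x)).

Lemma rtr_rup G G' B (r : rename G G') :
  rtr (rup (B := B) r) = rup (B := vtr R B) (rtr r).
Proof.
apply: rename_ext; apply: (var_tr_ind (G := B :: G)) => A x.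
rewrite /rtr var_tr_rectE; elim/var_cons_ind: A / x => //= A x.
by rewrite var_tr_rectE.
Qed.

Lemma rtr_VS G B :
  rtr (fun A (x : var G A) => VS B x) = fun A x => VS (vtr R B) x.
Proof.
by apply: rename_ext; apply: var_tr_ind => A x; rewrite /rtr var_tr_rectE.
Qed.

(** Lets one equation cover both translations. The [id] branch acts on [unit], the type assigned to
    terms that do not exist. *)
Definition trty_map G G'
    (f : forall D A, tm (ctxtr R G) D A -> tm (ctxtr R G') D A)
    D A : trty R G D A -> trty R G' D A :=
  match D with
  | None => f _ _
  | Some D =>
      match A return trty R G (Some D) A -> trty R G' (Some D) A with
      | VComp _ => f _ _
      | _ => id
      end
  end.

Lemma tr_ren G D A (t : tm G D A) G' (r : rename G G') :
  tr R (ren t r) = trty_map (fun _ _ u => ren u (rtr r)) (tr R t).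
Proof.
elim: t G' r => //=; intros;
 repeat match goal with D : stoup _ _ |- _ => destruct D end;
 simpl in *; rewrite_IH; rewrite ?rtr_rup; rewrite /rtr ?var_tr_rectE //;
 try by syn.
Qed.

Lemma tr_wk G A B (t : tm G None A) : tr R (wk B t) = wk (vtr R B) (tr R t).
Proof. by rewrite /wk tr_ren /= rtr_VS. Qed.

Lemma str_sup G G' B (s : subst G G') :
  str (sup (B := B) s) = sup (B := vtr R B) (str s).
Proof.
apply: subst_ext; apply: (var_tr_ind (G := B :: G)) => A x.
rewrite /str var_tr_rectE; elim/var_cons_ind: A / x => //= A x.
by rewrite tr_wk var_tr_rectE.
Qed.

(** The stoup is kept fixed: substitution for the context commutes with the translation on the nose,
    whereas substitution for the stoup is reversed and commutes only up to [eqtm] ([trc_lsub]). *)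
Lemma tr_sub G D A (t : tm G D A) G' (s : subst G G') :
  tr R (sub t s (ssub_id G' D)) =
  trty_map (fun D _ u => sub u (str s) (ssub_id _ D)) (tr R t).
Proof.
elim: t G' s => //=; intros;
 repeat match goal with D : stoup _ _ |- _ => destruct D end;
 simpl in *; rewrite_IH; rewrite ?str_sup; rewrite /str ?var_tr_rectE //;
 try by syn.
Qed.

End Translation.

(** * Stoup substitution through the term formers *)

Section LsubE.

Variables (V : Type) (K : eqType) (G : ctx V K) (D : stoup V K) (Z : ctype V K).
Variable (z : tm G D (VComp Z)).
Implicit Types (A B C : ctype V K) (X : vtype V K).

Lemma lsub_CStar : lsub CStar z = CStar.
Proof. by []. Qed.

Lemma lsub_CPair A B (t : tm G (Some Z) (VComp A))
    (u : tm G (Some Z) (VComp B)) :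
  lsub (CPair t u) z = CPair (lsub t z) (lsub u z).
Proof. by []. Qed.

Lemma lsub_CFst A B (t : tm G (Some Z) (VComp (CWith A B))) :
  lsub (CFst t) z = CFst (lsub t z).
Proof. by []. Qed.

Lemma lsub_CSnd A B (t : tm G (Some Z) (VComp (CWith A B))) :
  lsub (CSnd t) z = CSnd (lsub t z).
Proof. by []. Qed.

Lemma lsub_Abort A (t : tm G (Some Z) (VComp CZero)) :
  lsub (Abort A t) z = Abort A (lsub t z).
Proof. by []. Qed.

Lemma lsub_Inl A B (t : tm G (Some Z) (VComp A)) :
  lsub (Inl B t) z = Inl B (lsub t z).
Proof. by []. Qed.

Lemma lsub_Inr A B (t : tm G (Some Z) (VComp B)) :
  lsub (Inr A t) z = Inr A (lsub t z).
Proof. by []. Qed.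

Lemma lsub_CLam X B (t : tm (X :: G) (Some Z) (VComp B)) :
  lsub (CLam t) z = CLam (lsub t (wk X z)).
Proof. by rewrite /lsub /= sup_id. Qed.

Lemma lsub_CApp X B (s : tm G (Some Z) (VComp (CArr X B))) t :
  lsub (CApp s t) z = CApp (lsub s z) t.
Proof. by rewrite /lsub /= (sub_id t). Qed.

Lemma lsub_LetTop A (t : tm G (Some Z) (VComp CI)) (u : tm G None (VComp A)) :
  lsub (LetTop t u) z = LetTop (lsub t z) u.
Proof. by rewrite /lsub /= (sub_id u). Qed.

Lemma lsub_LetBang X B (t : tm G (Some Z) (VComp (CBang X)))
    (u : tm (X :: G) None (VComp B)) :
  lsub (LetBang t u) z = LetBang (lsub t z) u.
Proof. by rewrite /lsub /= sup_id (sub_id u). Qed.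

Lemma lsub_Tens X B t (u : tm G (Some Z) (VComp B)) :
  lsub (@Tens _ _ _ _ X _ t u) z = Tens t (lsub u z).
Proof. by rewrite /lsub /= (sub_id t). Qed.

Lemma lsub_LetTens X B C (s : tm G (Some Z) (VComp (CTens X B)))
    (t : tm (X :: G) (Some B) (VComp C)) :
  lsub (LetTens s t) z = LetTens (lsub s z) t.
Proof. by rewrite /lsub /= sup_id (sub_id t). Qed.

Lemma lsub_Case A B C (s : tm G (Some Z) (VComp (CPlus A B)))
    (t : tm G (Some A) (VComp C)) (u : tm G (Some B) (VComp C)) :
  lsub (Case s t u) z = Case (lsub s z) t u.
Proof. by rewrite /lsub /= (sub_id t) (sub_id u). Qed.

Lemma lsub_LApp A B (s : tm G None (VLolli A B)) (t : tm G (Some Z) (VComp A)) :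
  lsub (LApp s t) z = LApp s (lsub t z).
Proof. by rewrite /lsub /= (sub_id s). Qed.

Lemma lsub_SVarl : lsub SVar z = z.
Proof. by []. Qed.

Definition lsubE := (lsub_SVarl, lsub_CStar, lsub_CPair, lsub_CFst, lsub_CSnd,
  lsub_Abort, lsub_Inl, lsub_Inr, lsub_CLam, lsub_CApp, lsub_LetTop,
  lsub_LetBang, lsub_Tens, lsub_LetTens, lsub_Case, lsub_LApp).

End LsubE.

(** * A uniform translation for both stoups, and its soundness *)

Section Trc.

Variables (V : Type) (K : eqType) (R : ctype V K).
Implicit Types (G : ctx V K) (D : stoup V K) (A B C : ctype V K).
Implicit Types (X : vtype V K).

(** The empty stoup counts as I, and [ctr R CI] is [R]. *)
Definition stoup_tr D : ctype V K :=
  match D with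
  | None => R
  | Some A => ctr R A
  end.

(* A term t of a computation type with empty stoup is identified with the
   linear term k |-> t•{k}; the value and computation clauses of the translation
   then become instances of the same equations. *)
Definition trc G D B :
    tm G D (VComp B) -> tm (ctxtr R G) (Some (ctr R B)) (VComp (stoup_tr D)) :=
  match D return tm G D (VComp B) ->
    tm (ctxtr R G) (Some (ctr R B)) (VComp (stoup_tr D)) with
  | None => fun t => LApp (tr R t) SVar
  | Some _ => fun t => tr R t
  end.

Arguments trc : simpl never.

(** With a non-empty stoup a clause holds by computation; with an empty one, a single beta step
    removes the outer [LLam] of the value clause. *)
Ltac by_clause := intros; rewrite /trc;
  (repeat match goal with D : stoup _ _ |- _ => destruct D end) => //=;
  (etransitivity; [exact: beta_Lolli|]); apply: eqtm_eq; syn.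

Lemma trc_CStar G D : eqtm (@trc G D _ CStar) (Abort (stoup_tr D) SVar).
Proof. by_clause. Qed.

Lemma trc_CPair G D A B (t : tm G D (VComp A)) (u : tm G D (VComp B)) :
  eqtm (trc (CPair t u)) (Case SVar (trc t) (trc u)).
Proof. by_clause. Qed.

Lemma trc_CFst G D A B (t : tm G D (VComp (CWith A B))) :
  eqtm (trc (CFst t)) (lsub (trc t) (Inl (ctr R B) SVar)).
Proof. by_clause. Qed.

Lemma trc_CSnd G D A B (t : tm G D (VComp (CWith A B))) :
  eqtm (trc (CSnd t)) (lsub (trc t) (Inr (ctr R A) SVar)).
Proof. by_clause. Qed.

Lemma trc_CLam G D X B (t : tm (X :: G) D (VComp B)) :
  eqtm (trc (CLam t)) (LetTens (A := vtr R X) SVar (trc t)).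
Proof. by_clause. Qed.

Lemma trc_CApp G D X B (s : tm G D (VComp (CArr X B))) (t : tm G None X) :
  eqtm (trc (CApp s t)) (lsub (trc s) (Tens (A := vtr R X) (tr R t) SVar)).
Proof. by_clause. Qed.

Lemma trc_Top G : eqtm (trc (@Top _ _ G)) SVar.
Proof. by_clause. Qed.

Lemma trc_LetTop G D A (t : tm G D (VComp CI)) (u : tm G None (VComp A)) :
  eqtm (trc (LetTop t u)) (lsub (trc t) (trc u)).
Proof. by_clause. Qed.

Lemma trc_Bang G X (t : tm G None X) :
  eqtm (trc (Bang t)) (CApp (A := vtr R X) SVar (tr R t)).
Proof. by_clause. Qed.

Lemma trc_LetBang G D X B (t : tm G D (VComp (CBang X)))
    (u : tm (X :: G) None (VComp B)) :
  eqtm (trc (LetBang t u)) (lsub (trc t) (CLam (A := vtr R X) (trc u))).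
Proof. by_clause. Qed.

Lemma trc_Tens G D X B (t : tm G None X) (u : tm G D (VComp B)) :
  eqtm (trc (Tens t u)) (lsub (trc u) (CApp (A := vtr R X) SVar (tr R t))).
Proof. by_clause. Qed.

Lemma trc_LetTens G D X B C (s : tm G D (VComp (CTens X B)))
    (t : tm (X :: G) (Some B) (VComp C)) :
  eqtm (trc (LetTens s t)) (lsub (trc s) (CLam (A := vtr R X) (trc t))).
Proof. by_clause. Qed.

Lemma trc_Abort G D A (t : tm G D (VComp CZero)) :
  eqtm (trc (Abort A t)) (lsub (trc t) CStar).
Proof. by_clause. Qed.

Lemma trc_Inl G D A B (t : tm G D (VComp A)) :
  eqtm (trc (Inl B t)) (lsub (trc t) (CFst SVar)).
Proof. by_clause. Qed.

Lemma trc_Inr G D A B (t : tm G D (VComp B)) :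
  eqtm (trc (Inr A t)) (lsub (trc t) (CSnd SVar)).
Proof. by_clause. Qed.

Lemma trc_Case G D A B C (s : tm G D (VComp (CPlus A B)))
    (t : tm G (Some A) (VComp C)) (u : tm G (Some B) (VComp C)) :
  eqtm (trc (Case s t u)) (lsub (trc s) (CPair (trc t) (trc u))).
Proof. by_clause. Qed.

Lemma trc_LApp G D A B (s : tm G None (VLolli A B)) (t : tm G D (VComp A)) :
  eqtm (trc (LApp s t))
    (lsub (trc t) (LApp (A := ctr R B) (B := ctr R A) (tr R s) SVar)).
Proof. by_clause. Qed.

Lemma trc_sub G D B (t : tm G D (VComp B)) G' (s : subst G G') :
  trc (sub t s (ssub_id G' D)) = sub (trc t) (str s) (SOne SVar).
Proof. by case: D t => [A|] t; rewrite /trc tr_sub. Qed.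

Lemma str_scons G X (u : tm G None X) :
  str (R := R) (scons u (@idsub V K G)) =
  scons (tr R u) (@idsub V K (ctxtr R G)).
Proof.
apply: subst_ext; apply: (var_tr_ind (G := X :: G)) => Y x.
by rewrite /str var_tr_rectE; elim/var_cons_ind: Y / x.
Qed.

Lemma trc_vsub G D X B (t : tm (X :: G) D (VComp B)) (u : tm G None X) :
  trc (vsub t u) = vsub (A := vtr R X) (trc t) (tr R u).
Proof. by rewrite /vsub trc_sub str_scons. Qed.

Lemma tr_vsub G X Y (t : tm (X :: G) None Y) (u : tm G None X) :
  tr R (vsub t u) = vsub (A := vtr R X) (tr R t) (tr R u).
Proof. by rewrite /vsub tr_sub str_scons. Qed.

Lemma trc_wk G D X B (t : tm G D (VComp B)) :
  trc (wk X t) = wk (vtr R X) (trc t).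
Proof. by case: D t => [A|] t; rewrite /trc /wk tr_ren /= rtr_VS. Qed.

Lemma vlsubE G D X B C (t : tm (X :: G) (Some B) (VComp C)) u
    (v : tm G D (VComp B)) : vlsub t u v = lsub (vsub t u) v.
Proof. syn. Qed.

(** The matches only make the indices general enough for induction. Most clauses are themselves
    compositions, so the step is associativity, [lsub_lsub]. The introductions of 1, & and ⇒ are
    translated to eliminators at the stoup variable and need the commuting conversions. *)
Lemma trc_lsub_gen G D X (t : tm G D X) :
  match D return tm G D X -> Prop with
  | None => fun=> True
  | Some A =>
      match X return tm G (Some A) X -> Prop with
      | VComp B => fun t => forall E (u : tm G E (VComp A)),
          eqtm (trc (lsub t u)) (lsub (trc u) (trc t))
      | _ => fun=> True
      end
  end t.
Proof.
elim: t => {G D X} //=.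
- by move=> G A E u; rewrite lsubE lsub_SVarr.
- by move=> G [Z|] //= E u; rewrite lsubE !trc_CStar lsub_of_Abort.
- move=> G [Z|] //= A B t IHt t' IHt' E u.
  by rewrite lsubE !trc_CPair IHt IHt' lsub_of_Case.
- by move=> G [Z|] //= A B t IH E u; rewrite lsubE !trc_CFst IH lsub_lsub.
- by move=> G [Z|] //= A B t IH E u; rewrite lsubE !trc_CSnd IH lsub_lsub.
- move=> G [Z|] //= X B t IH E u.
  by rewrite lsubE !trc_CLam IH trc_wk lsub_of_LetTens.
- by move=> G [Z|] //= X B s IH t _ E u; rewrite lsubE !trc_CApp IH lsub_lsub.
- by move=> G [Z|] //= A s IH t _ E u; rewrite lsubE !trc_LetTop IH lsub_lsub.
- move=> G [Z|] //= X B s IH t _ E u.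
  by rewrite lsubE !trc_LetBang IH lsub_lsub.
- by move=> G [Z|] //= X B s _ t IH E u; rewrite lsubE !trc_Tens IH lsub_lsub.
- move=> G [Z|] //= X B C s IH t _ E u.
  by rewrite lsubE !trc_LetTens IH lsub_lsub.
- by move=> G [Z|] //= A t IH E u; rewrite lsubE !trc_Abort IH lsub_lsub.
- by move=> G [Z|] //= A B t IH E u; rewrite lsubE !trc_Inl IH lsub_lsub.
- by move=> G [Z|] //= A B t IH E u; rewrite lsubE !trc_Inr IH lsub_lsub.
- move=> G [Z|] //= A B C s IH t _ t' _ E u.
  by rewrite lsubE !trc_Case IH lsub_lsub.
- by move=> G [Z|] //= A B s _ t IH E u; rewrite lsubE !trc_LApp IH lsub_lsub.
Qed.

Lemma trc_lsub G D A B (t : tm G (Some A) (VComp B)) (u : tm G D (VComp A)) :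
  eqtm (trc (lsub t u)) (lsub (trc u) (trc t)).
Proof. exact: (trc_lsub_gen t). Qed.

(** At computation types the comparison goes through [trc], so that both stoup cases of a rule are a
    single case; [treqE] recovers the value translation. *)
Definition treq G D X : tm G D X -> tm G D X -> Prop :=
  match X return tm G D X -> tm G D X -> Prop with
  | VComp B => fun t u => eqtm (trc t) (trc u)
  | Y => match D return tm G D Y -> tm G D Y -> Prop with
         | None => fun t u => eqtm (tr R t) (tr R u)
         | Some _ => fun _ _ => True
         end
  end.

Lemma treqE G X (t u : tm G None X) : treq t u <-> eqtm (tr R t) (tr R u).
Proof.
case: X t u => //= B t u; rewrite /trc; split=> [|->] //.
exact: Lolli_ext.
Qed.

(** The translation is a duality on axioms: those of & become those of ⊕, those of 1 that of 0,
    those of ⇒ and ⊗ are exchanged, and those of ! become those of ⇒. The axioms of I reduce to unit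
    laws of composition. *)
Lemma treq_sound G D X (t u : tm G D X) : eqtm t u -> treq t u.
Proof.
elim=> {G D X t u} /=.
- by move=> G [Z|] [] * /=.
- by move=> G D X t u _; case: X t u => //=; case: D => //= *; symmetry.
- move=> G D X t u v _ + _; case: X t u v => //=; case: D => //= *;
  by etransitivity; eauto.
- by move=> G X Y t t' u u' _ /treqE h _ /treqE h'; rewrite h h'.
- by move=> G X Y t t' _ h; apply/treqE; rewrite /= h.
- by move=> G X Y t t' _ h; apply/treqE; rewrite /= h.
- by move=> G X Y t t' _ /treqE h; rewrite h.
- by move=> G X Y t t' u u' _ h _ /treqE h'; apply/treqE; rewrite /= h h'.
- by move=> G D A B t t' u u' _ h _ h'; rewrite !trc_CPair h h'.
- by move=> G D A B t t' _ h; rewrite !trc_CFst h.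
- by move=> G D A B t t' _ h; rewrite !trc_CSnd h.
- by move=> G D X B t t' _ h; rewrite !trc_CLam h.
- by move=> G D X B t t' u u' _ h _ /treqE h'; rewrite !trc_CApp h h'.
- by move=> G D A t t' u u' _ h _ h'; rewrite !trc_LetTop h h'.
- by move=> G X t t' _ /treqE h; rewrite !trc_Bang h.
- by move=> G D X B t t' u u' _ h _ h'; rewrite !trc_LetBang h h'.
- by move=> G D X B t t' u u' _ /treqE h _ h'; rewrite !trc_Tens h h'.
- by move=> G D X B C t t' u u' _ h _ h'; rewrite !trc_LetTens h h'.
- by move=> G D A t t' _ h; rewrite !trc_Abort h.
- by move=> G D A B t t' _ h; rewrite !trc_Inl h.
- by move=> G D A B t t' _ h; rewrite !trc_Inr h.
- by move=> G D A B C s s' t t' u u' _ h _ h' _ h2; rewrite !trc_Case h h' h2.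
- by move=> G A B t t' _ h; apply: eqtm_LLam.
- by move=> G D A B s s' t t' _ h _ h'; rewrite !trc_LApp h h'.
- by move=> G t; apply: eta_One.
- by move=> G X Y t u; apply/treqE; apply: beta_Fst.
- by move=> G X Y t u; apply/treqE; apply: beta_Snd.
- by move=> G X Y t; apply: eta_Prod.
- by move=> G X Y t u; apply/treqE; rewrite tr_vsub; apply: beta_Arr.
- by move=> G X Y t; rewrite tr_wk; apply: eta_Arr.
- move=> G D t; rewrite trc_CStar; symmetry.
  by etransitivity; [apply: (eta_Zero _ (trc t))|rewrite lsub_SVarr].
- move=> G D A B t u; rewrite trc_CFst trc_CPair !lsubE.
  by rewrite beta_Inl lsub_SVarr.
- move=> G D A B t u; rewrite trc_CSnd trc_CPair !lsubE.
  by rewrite beta_Inr lsub_SVarr.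
- by move=> G D A B t; rewrite trc_CPair trc_CFst trc_CSnd eta_Plus lsub_SVarr.
- move=> G D X B t u; rewrite trc_CApp trc_CLam !lsubE beta_Tens.
  by rewrite vlsubE lsub_SVarr trc_vsub.
- move=> G D X B t; rewrite trc_CLam trc_CApp trc_wk.
  by etransitivity; [apply: eta_Tens|rewrite lsub_SVarr].
- by move=> G A t; rewrite trc_LetTop trc_Top lsubE.
- by move=> G D A t u; rewrite trc_LetTop !trc_lsub trc_Top lsubE.
- move=> G X B t u; rewrite trc_LetBang trc_Bang !lsubE beta_CArr.
  by rewrite trc_vsub.
- move=> G D X B t u; rewrite trc_LetBang !trc_lsub trc_Bang trc_wk !lsubE.
  by rewrite eta_CArr.
- move=> G D X B C t s u; rewrite trc_LetTens trc_Tens vlsubE.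
  rewrite trc_lsub lsub_lsub.
  by rewrite !lsubE beta_CArr trc_vsub.
- move=> G D X B C t u; rewrite trc_LetTens !trc_lsub trc_Tens trc_wk !lsubE.
  by rewrite eta_CArr.
- by move=> G D A t u; rewrite trc_Abort trc_lsub -(eta_COne (trc u)).
- move=> G D A B C t u u'; rewrite trc_Case trc_Inl trc_lsub lsub_lsub !lsubE.
  by rewrite beta_CFst.
- move=> G D A B C t u u'; rewrite trc_Case trc_Inr trc_lsub lsub_lsub !lsubE.
  by rewrite beta_CSnd.
- move=> G D A B C t u; rewrite trc_Case !trc_lsub trc_Inl trc_Inr !lsubE.
  by rewrite eta_With.
- by move=> G D A B t u; rewrite trc_LApp trc_lsub /= beta_Lolli lsub_SVarr.
- by move=> G A B t; rewrite lsubE eta_Lolli.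
Qed.

Lemma tr_sound G X (t u : tm G None X) : eqtm t u -> eqtm (tr R t) (tr R u).
Proof. by move/treq_sound/treqE. Qed.

Lemma trc_sound G D B (t u : tm G D (VComp B)) :
  eqtm t u -> eqtm (trc t) (trc u).
Proof. exact: treq_sound. Qed.

End Trc.

(** * Derived equations and coercions along type equalities *)

Section Derived.

Variables (V : Type) (K : eqType).
Implicit Types (G : ctx V K) (D : stoup V K) (A B C : ctype V K).
Implicit Types (X Y : vtype V K).

(** Written as a stoup substitution, a linear application becomes subject to the commuting
    conversions. *)
Lemma LApp_lsub G D A B (f : tm G None (VLolli A B)) (t : tm G D (VComp A)) :
  LApp f t = lsub (LApp f SVar) t.
Proof. by rewrite !lsubE. Qed.

Lemma wk_LApp G D A B X (f : tm G None (VLolli A B)) (t : tm G D (VComp A)) :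
  wk X (LApp f t) = LApp (wk X f) (wk X t).
Proof. by []. Qed.

Lemma LApp_LetTop G D A B (f : tm G None (VLolli A B))
    (s : tm G D (VComp CI)) t :
  eqtm (LApp f (LetTop s t)) (LetTop s (LApp f t)).
Proof. by rewrite LApp_lsub lsub_of_LetTop !lsubE. Qed.

Lemma LApp_LetBang G D X A B (f : tm G None (VLolli A B))
    (s : tm G D (VComp (CBang X))) t :
  eqtm (LApp f (LetBang s t)) (LetBang s (LApp (wk X f) t)).
Proof. by rewrite LApp_lsub lsub_of_LetBang wk_LApp !lsubE. Qed.

Lemma LApp_LetTens G D X A B C (f : tm G None (VLolli A B))
    (s : tm G D (VComp (CTens X C))) t :
  eqtm (LApp f (LetTens s t)) (LetTens s (LApp (wk X f) t)).
Proof. by rewrite LApp_lsub lsub_of_LetTens wk_LApp !lsubE. Qed.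

Lemma LApp_Case G D A B C C' (f : tm G None (VLolli A B))
    (s : tm G D (VComp (CPlus C C'))) t u :
  eqtm (LApp f (Case s t u)) (Case s (LApp f t) (LApp f u)).
Proof. by rewrite LApp_lsub lsub_of_Case !lsubE. Qed.

Lemma LApp_Abort G D A B (f : tm G None (VLolli A B))
    (s : tm G D (VComp CZero)) :
  eqtm (LApp f (Abort A s)) (Abort B s).
Proof. by rewrite LApp_lsub lsub_of_Abort. Qed.

Lemma LetBang_Bang G D X (t : tm G D (VComp (CBang X))) :
  eqtm (LetBang t (Bang (Var VZ))) t.
Proof. exact: (eta_Bang t SVar). Qed.

Lemma LetTens_Tens G D X B (t : tm G D (VComp (CTens X B))) :
  eqtm (LetTens t (Tens (Var VZ) SVar)) t.
Proof. exact: (eta_Tens t SVar). Qed.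

Lemma Case_Inl_Inr G D A B (t : tm G D (VComp (CPlus A B))) :
  eqtm (Case t (Inl B SVar) (Inr A SVar)) t.
Proof. exact: (eta_Plus t SVar). Qed.

Lemma LetTop_LApp G D A (f : tm G None (VLolli CI A)) (t : tm G D (VComp CI)) :
  eqtm (LetTop t (LApp f Top)) (LApp f t).
Proof.
by apply: (eqtm_eqlr _ (eta_I t (LApp f SVar))); rewrite !lsubE.
Qed.

Lemma LetTens_LetTens G D X X' B B' C (s : tm G D (VComp (CTens X B)))
    (a : tm (X :: G) None X') (b : tm (X :: G) (Some B) (VComp B'))
    (w : tm (X' :: G) (Some B') (VComp C)) :
  eqtm (LetTens (LetTens s (Tens a b)) w)
    (LetTens s (sub w (scons a (fun Y x => Var (VS X x))) (SOne b))).
Proof.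
have -> : LetTens (LetTens s (Tens a b)) w =
  lsub (LetTens SVar w) (LetTens s (Tens a b)) by rewrite !lsubE.
rewrite lsub_of_LetTens; apply: eqtm_LetTens => //.
have -> : wk X (LetTens SVar w) =
    LetTens SVar (ren w (rup (fun Y x => VS X x))).
  by [].
rewrite !lsubE beta_Tens; apply: eqtm_eq; syn.
Qed.

Lemma LetTens_LetBang G D X X' B' C (s : tm G D (VComp (CBang X)))
    (a : tm (X :: G) None X') (b : tm (X :: G) None (VComp B'))
    (w : tm (X' :: G) (Some B') (VComp C)) :
  eqtm (LetTens (LetBang s (Tens a b)) w)
    (LetBang s (sub w (scons a (fun Y x => Var (VS X x))) (SOne b))).
Proof.
have -> : LetTens (LetBang s (Tens a b)) w =
  lsub (LetTens SVar w) (LetBang s (Tens a b)) by rewrite !lsubE.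
rewrite lsub_of_LetBang; apply: eqtm_LetBang => //.
have -> : wk X (LetTens SVar w) =
    LetTens SVar (ren w (rup (fun Y x => VS X x))).
  by [].
rewrite !lsubE beta_Tens; apply: eqtm_eq; syn.
Qed.

Lemma Case_Case G D A B A' B' C (s : tm G D (VComp (CPlus A B)))
    (a : tm G (Some A) (VComp A')) (b : tm G (Some B) (VComp B'))
    (w : tm G (Some A') (VComp C)) (w' : tm G (Some B') (VComp C)) :
  eqtm (Case (Case s (Inl B' a) (Inr A' b)) w w')
    (Case s (lsub w a) (lsub w' b)).
Proof.
have -> : Case (Case s (Inl B' a) (Inr A' b)) w w' =
  lsub (Case SVar w w') (Case s (Inl B' a) (Inr A' b)) by rewrite !lsubE.
by rewrite lsub_of_Case !lsubE beta_Inl beta_Inr.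
Qed.

Lemma wk_App G X Y Z (f : tm G None (VArr X Y)) (t : tm G None X) :
  wk Z (App f t) = App (wk Z f) (wk Z t).
Proof. by []. Qed.

Lemma Arr_ext G X Y (t u : tm G None (VArr X Y)) :
  eqtm (App (wk X t) (Var VZ)) (App (wk X u) (Var VZ)) -> eqtm t u.
Proof. by move=> h; rewrite -(eta_Arr t) -(eta_Arr u) h. Qed.

Lemma CArr_ext G D X B (t u : tm G D (VComp (CArr X B))) :
  eqtm (CApp (wk X t) (Var VZ)) (CApp (wk X u) (Var VZ)) -> eqtm t u.
Proof. by move=> h; rewrite -(eta_CArr t) -(eta_CArr u) h. Qed.

(** Keeps transport inside the calculus: a type equality becomes a linear isomorphism, handled by
    [castLK] and [castLVK] alone. *)
Definition castL A B (e : A = B) G : tm G None (VLolli A B) :=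
  match e with
  | erefl => LLam SVar
  end.

Lemma sub_castL A B (e : A = B) G G' (s : subst G G') :
  sub (castL e G) s SNil = castL e G'.
Proof. by case: B / e. Qed.

Lemma castLK A B (e : A = B) G D (t : tm G D (VComp A)) :
  eqtm (LApp (castL (esym e) G) (LApp (castL e G) t)) t.
Proof. by case: B / e; rewrite /= !beta_Lolli. Qed.

Lemma castLVK A B (e : A = B) G D (t : tm G D (VComp B)) :
  eqtm (LApp (castL e G) (LApp (castL (esym e) G) t)) t.
Proof. by case: B / e t => t; rewrite /= !beta_Lolli. Qed.

End Derived.

(** * The double translation *)

Section DoubleTranslation.

Variables (V : Type) (K : eqType) (R : ctype V K).
Implicit Types (G : ctx V K) (D : stoup V K) (A B C : ctype V K).
Implicit Types (X Y : vtype V K).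

Definition ttc G D B (t : tm G D (VComp B)) := trc R (trc R t).

Arguments ttc : simpl never.

Lemma trc_SVar G A : trc R (@SVar V K G A) = SVar.
Proof. by []. Qed.

(** The clause of the inner translation is used under the outer one by soundness; the clause of the
    outer one follows. *)
Ltac tt := rewrite /ttc; etransitivity; first apply: trc_sound.

Lemma ttc_CPair G D A B (t : tm G D (VComp A)) (u : tm G D (VComp B)) :
  eqtm (ttc (CPair t u)) (CPair (ttc t) (ttc u)).
Proof. tt; first exact: trc_CPair. by rewrite trc_Case trc_SVar !lsubE. Qed.

Lemma ttc_CFst G D A B (t : tm G D (VComp (CWith A B))) :
  eqtm (ttc (CFst t)) (CFst (ttc t)).
Proof.
tt; first exact: trc_CFst. by rewrite trc_lsub trc_Inl trc_SVar !lsubE.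
Qed.

Lemma ttc_CSnd G D A B (t : tm G D (VComp (CWith A B))) :
  eqtm (ttc (CSnd t)) (CSnd (ttc t)).
Proof.
tt; first exact: trc_CSnd. by rewrite trc_lsub trc_Inr trc_SVar !lsubE.
Qed.

Lemma ttc_CLam G D X B (t : tm (X :: G) D (VComp B)) :
  eqtm (ttc (CLam t)) (CLam (A := vtr R (vtr R X)) (ttc t)).
Proof. tt; first exact: trc_CLam. by rewrite trc_LetTens trc_SVar !lsubE. Qed.

Lemma ttc_CApp G D X B (s : tm G D (VComp (CArr X B))) (t : tm G None X) :
  eqtm (ttc (CApp s t)) (CApp (A := vtr R (vtr R X)) (ttc s) (tr R (tr R t))).
Proof.
tt; first exact: trc_CApp.
by rewrite trc_lsub (trc_Tens R (X := vtr R X)) trc_SVar !lsubE.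
Qed.

(** Both the empty stoup and I have double translation R°, and ⊤ becomes the identity between them.
    Accordingly [LetTop] becomes composition. *)
Lemma ttc_Top G : eqtm (ttc (@Top _ _ G)) SVar.
Proof. tt; first exact: trc_Top. by rewrite trc_SVar. Qed.

Lemma ttc_LetTop G D A (t : tm G D (VComp CI)) (u : tm G None (VComp A)) :
  eqtm (ttc (LetTop t u)) (lsub (ttc u) (ttc t)).
Proof. tt; first exact: trc_LetTop. by rewrite trc_lsub. Qed.

(** Here (!A)° = A• ⇒ R, hence (!A)°° = !A•• ⊗ R°, whose second component is the stoup. *)
Lemma ttc_Bang G X (t : tm G None X) :
  eqtm (ttc (Bang t)) (Tens (A := vtr R (vtr R X)) (tr R (tr R t)) SVar).
Proof.
tt; first exact: trc_Bang.
by rewrite (trc_CApp R (X := vtr R X)) trc_SVar !lsubE.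
Qed.

Lemma ttc_LetBang G D X B (t : tm G D (VComp (CBang X)))
    (u : tm (X :: G) None (VComp B)) :
  eqtm (ttc (LetBang t u)) (LetTens (A := vtr R (vtr R X)) (ttc t) (ttc u)).
Proof.
tt; first exact: trc_LetBang.
by rewrite trc_lsub (trc_CLam R (X := vtr R X)) !lsubE.
Qed.

Lemma ttc_Tens G D X B (t : tm G None X) (u : tm G D (VComp B)) :
  eqtm (ttc (Tens t u)) (Tens (A := vtr R (vtr R X)) (tr R (tr R t)) (ttc u)).
Proof.
tt; first exact: trc_Tens.
by rewrite trc_lsub (trc_CApp R (X := vtr R X)) trc_SVar !lsubE.
Qed.

Lemma ttc_LetTens G D X B C (s : tm G D (VComp (CTens X B)))
    (t : tm (X :: G) (Some B) (VComp C)) :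
  eqtm (ttc (LetTens s t)) (LetTens (A := vtr R (vtr R X)) (ttc s) (ttc t)).
Proof.
tt; first exact: trc_LetTens.
by rewrite trc_lsub (trc_CLam R (X := vtr R X)) !lsubE.
Qed.

Lemma ttc_Abort G D A (t : tm G D (VComp CZero)) :
  eqtm (ttc (Abort A t)) (Abort _ (ttc t)).
Proof.
tt; first exact: trc_Abort. by rewrite trc_lsub trc_CStar !lsubE.
Qed.

Lemma ttc_Inl G D A B (t : tm G D (VComp A)) :
  eqtm (ttc (Inl B t)) (Inl _ (ttc t)).
Proof.
tt; first exact: trc_Inl. by rewrite trc_lsub trc_CFst trc_SVar !lsubE.
Qed.

Lemma ttc_Inr G D A B (t : tm G D (VComp B)) :
  eqtm (ttc (Inr A t)) (Inr _ (ttc t)).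
Proof.
tt; first exact: trc_Inr. by rewrite trc_lsub trc_CSnd trc_SVar !lsubE.
Qed.

Lemma ttc_Case G D A B C (s : tm G D (VComp (CPlus A B)))
    (t : tm G (Some A) (VComp C)) (u : tm G (Some B) (VComp C)) :
  eqtm (ttc (Case s t u)) (Case (ttc s) (ttc t) (ttc u)).
Proof.
tt; first exact: trc_Case. by rewrite trc_lsub trc_CPair !lsubE.
Qed.

Lemma ttc_LApp G D A B (s : tm G None (VLolli A B)) (t : tm G D (VComp A)) :
  eqtm (ttc (LApp s t))
    (LApp (A := ctr R (ctr R A)) (B := ctr R (ctr R B))
       (tr R (tr R s)) (ttc t)).
Proof.
tt; first exact: trc_LApp.
by rewrite trc_lsub (trc_LApp R (A := ctr R B) (B := ctr R A)) trc_SVar !lsubE.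
Qed.

End DoubleTranslation.

Scheme vtype_mut := Induction for vtype Sort Prop
with ctype_mut := Induction for ctype Sort Prop.
Combined Scheme vctype_ind from vtype_mut, ctype_mut.

(** * The isomorphisms A → A•• and A ⊸ A°° *)

Section Iso.

Variables (V : Type) (K : eqType) (R : ctype V K).
(** The assumption on [R] enters only through this equation and the next. *)
Hypothesis hI : ctr R R = CI.
Hypothesis hK : forall a, ctr R (ctr R (CConst a)) = CConst a.
Implicit Types (G : ctx V K) (D : stoup V K) (A B C : ctype V K).
Implicit Types (X Y : vtype V K).

(** Both directions are defined at once, since the domains of →, ⇒ and ⊸ call for the inverse. At a
    computation type A, A•• is R° ⊸ A°°, and a term goes to the map out of R° ≅ I sending the unit
    to its image; the inverse evaluates at the unit. At !X, the double translation !X•• ⊗ R° is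
    filled with the same unit. *)
Fixpoint vup X G : tm G None (VArr X (vtr R (vtr R X))) :=
  match X return tm G None (VArr X (vtr R (vtr R X))) with
  | VConst _ => Lam (Var VZ)
  | VOne => Lam (Var VZ)
  | VProd X Y =>
      Lam (Pair (App (vup X _) (Fst (Var VZ))) (App (vup Y _) (Snd (Var VZ))))
  | VArr X Y =>
      Lam (Lam (App (vup Y _) (App (Var (VS _ VZ)) (App (vdn X _) (Var VZ)))))
  | VComp A =>
      Lam (LLam (LetTop (LApp (castL hI _) SVar) (LApp (cup A _) (Var VZ))))
  | VLolli A B =>
      Lam (LLam (LApp (cup B _) (LApp (Var VZ) (LApp (cdn A _) SVar))))
  end
with vdn X G : tm G None (VArr (vtr R (vtr R X)) X) :=
  match X return tm G None (VArr (vtr R (vtr R X)) X) with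
  | VConst _ => Lam (Var VZ)
  | VOne => Lam (Var VZ)
  | VProd X Y =>
      Lam (Pair (App (vdn X _) (Fst (Var VZ))) (App (vdn Y _) (Snd (Var VZ))))
  | VArr X Y =>
      Lam (Lam (App (vdn Y _) (App (Var (VS _ VZ)) (App (vup X _) (Var VZ)))))
  | VComp A =>
      Lam (LApp (cdn A _) (LApp (Var VZ) (LApp (castL (esym hI) _) Top)))
  | VLolli A B =>
      Lam (LLam (LApp (cdn B _) (LApp (Var VZ) (LApp (cup A _) SVar))))
  end
with cup A G : tm G None (VLolli A (ctr R (ctr R A))) :=
  match A return tm G None (VLolli A (ctr R (ctr R A))) with
  | CConst a => castL (esym (hK a)) _
  | COne => LLam SVar
  | CWith A B =>
      LLam (CPair (LApp (cup A _) (CFst SVar)) (LApp (cup B _) (CSnd SVar)))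
  | CArr X B =>
      LLam (CLam (LApp (cup B _) (CApp SVar (App (vdn X _) (Var VZ)))))
  | CI => castL (esym hI) _
  | CBang X =>
      LLam (LetBang SVar
        (Tens (App (vup X _) (Var VZ)) (LApp (castL (esym hI) _) Top)))
  | CTens X B =>
      LLam (LetTens SVar (Tens (App (vup X _) (Var VZ)) (LApp (cup B _) SVar)))
  | CZero => LLam SVar
  | CPlus A B =>
      LLam (Case SVar (Inl _ (LApp (cup A _) SVar))
        (Inr _ (LApp (cup B _) SVar)))
  end
with cdn A G : tm G None (VLolli (ctr R (ctr R A)) A) :=
  match A return tm G None (VLolli (ctr R (ctr R A)) A) with
  | CConst a => castL (hK a) _
  | COne => LLam SVar
  | CWith A B =>
      LLam (CPair (LApp (cdn A _) (CFst SVar)) (LApp (cdn B _) (CSnd SVar)))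
  | CArr X B =>
      LLam (CLam (LApp (cdn B _) (CApp SVar (App (vup X _) (Var VZ)))))
  | CI => castL hI _
  | CBang X =>
      LLam (LetTens SVar
        (LetTop (LApp (castL hI _) SVar) (Bang (App (vdn X _) (Var VZ)))))
  | CTens X B =>
      LLam (LetTens SVar (Tens (App (vdn X _) (Var VZ)) (LApp (cdn B _) SVar)))
  | CZero => LLam SVar
  | CPlus A B =>
      LLam (Case SVar (Inl _ (LApp (cdn A _) SVar))
        (Inr _ (LApp (cdn B _) SVar)))
  end.

(** The context is a mere parameter of the isomorphisms, which contain no free variable. *)
Lemma sub_iso :
  (forall X, (forall G G' (s : subst G G'), sub (vup X G) s SNil = vup X G') /\
     (forall G G' (s : subst G G'), sub (vdn X G) s SNil = vdn X G')) /\
  (forall A, (forall G G' (s : subst G G'), sub (cup A G) s SNil = cup A G') /\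
     (forall G G' (s : subst G G'), sub (cdn A G) s SNil = cdn A G')).
Proof.
apply: vctype_ind => /=; intros;
  repeat match goal with H : _ /\ _ |- _ => destruct H end;
  split=> * /=; rewrite ?sub_castL; rewrite_IH => //.
Qed.

Lemma sub_vup X G G' (s : subst G G') : sub (vup X G) s SNil = vup X G'.
Proof. by case: sub_iso => h _; case: (h X). Qed.

Lemma sub_vdn X G G' (s : subst G G') : sub (vdn X G) s SNil = vdn X G'.
Proof. by case: sub_iso => h _; case: (h X). Qed.

Lemma sub_cup A G G' (s : subst G G') : sub (cup A G) s SNil = cup A G'.
Proof. by case: sub_iso => _ h; case: (h A). Qed.

Lemma sub_cdn A G G' (s : subst G G') : sub (cdn A G) s SNil = cdn A G'.
Proof. by case: sub_iso => _ h; case: (h A). Qed.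

Definition sub_isoE := (sub_vup, sub_vdn, sub_cup, sub_cdn, sub_castL).

Lemma wk_castL A B (e : A = B) Y G : wk Y (castL e G) = castL e _.
Proof. by rewrite /wk renE sub_isoE. Qed.

Lemma wk_vup X Y G : wk Y (vup X G) = vup X _.
Proof. by rewrite /wk renE sub_isoE. Qed.

Lemma wk_vdn X Y G : wk Y (vdn X G) = vdn X _.
Proof. by rewrite /wk renE sub_isoE. Qed.

Lemma wk_cup A Y G : wk Y (cup A G) = cup A _.
Proof. by rewrite /wk renE sub_isoE. Qed.

Lemma wk_cdn A Y G : wk Y (cdn A G) = cdn A _.
Proof. by rewrite /wk renE sub_isoE. Qed.

Definition wk_isoE := (wk_vup, wk_vdn, wk_cup, wk_cdn, wk_castL).

Arguments vup : simpl never.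
Arguments vdn : simpl never.
Arguments cup : simpl never.
Arguments cdn : simpl never.

(** * Computation rules of the isomorphisms *)

Lemma App_vup_Const G a t : eqtm (App (vup (VConst a) G) t) t.
Proof. exact: beta_Arr. Qed.

Lemma App_vdn_Const G a t : eqtm (App (vdn (VConst a) G) t) t.
Proof. exact: beta_Arr. Qed.

Lemma App_vup_Prod G X Y t :
  eqtm (App (vup (VProd X Y) G) t)
    (Pair (App (vup X G) (Fst t)) (App (vup Y G) (Snd t))).
Proof.
apply: (eqtm_eqlr erefl (beta_Arr _ _)); by rewrite /vsub /= !sub_isoE.
Qed.

Lemma App_vdn_Prod G X Y t :
  eqtm (App (vdn (VProd X Y) G) t)
    (Pair (App (vdn X G) (Fst t)) (App (vdn Y G) (Snd t))).
Proof.
apply: (eqtm_eqlr erefl (beta_Arr _ _)); by rewrite /vsub /= !sub_isoE.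
Qed.

Lemma App_vup_Arr G X Y f u :
  eqtm (App (App (vup (VArr X Y) G) f) u)
    (App (vup Y G) (App f (App (vdn X G) u))).
Proof.
have -> : eqtm (App (vup (VArr X Y) G) f)
    (Lam (App (vup Y _) (App (wk _ f) (App (vdn X _) (Var VZ))))).
  by apply: (eqtm_eqlr erefl (beta_Arr _ _)); rewrite /vsub /= !sub_isoE.
by apply: (eqtm_eqlr erefl (beta_Arr _ _)); rewrite /vsub /= !sub_isoE; syn.
Qed.

Lemma App_vdn_Arr G X Y f u :
  eqtm (App (App (vdn (VArr X Y) G) f) u)
    (App (vdn Y G) (App f (App (vup X G) u))).
Proof.
have -> : eqtm (App (vdn (VArr X Y) G) f)
    (Lam (App (vdn Y _) (App (wk _ f) (App (vup X _) (Var VZ))))).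
  by apply: (eqtm_eqlr erefl (beta_Arr _ _)); rewrite /vsub /= !sub_isoE.
by apply: (eqtm_eqlr erefl (beta_Arr _ _)); rewrite /vsub /= !sub_isoE; syn.
Qed.

Lemma LApp_vup_Comp G D A t (u : tm G D (VComp (ctr R R))) :
  eqtm (LApp (App (vup (VComp A) G) t) u)
    (LetTop (LApp (castL hI G) u) (LApp (cup A G) t)).
Proof.
have -> : eqtm (App (vup (VComp A) G) t)
    (LLam (LetTop (LApp (castL hI G) SVar) (LApp (cup A G) t))).
  by apply: (eqtm_eqlr erefl (beta_Arr _ _)); rewrite /vsub /= !sub_isoE.
by rewrite beta_Lolli !lsubE.
Qed.

Lemma App_vdn_Comp G A t :
  eqtm (App (vdn (VComp A) G) t)
    (LApp (cdn A G) (LApp t (LApp (castL (esym hI) G) Top))).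
Proof.
by apply: (eqtm_eqlr erefl (beta_Arr _ _)); rewrite /vsub /= !sub_isoE.
Qed.

Lemma LApp_vup_Lolli G D A B f (u : tm G D (VComp (ctr R (ctr R A)))) :
  eqtm (LApp (App (vup (VLolli A B) G) f) u)
    (LApp (cup B G) (LApp f (LApp (cdn A G) u))).
Proof.
have -> : eqtm (App (vup (VLolli A B) G) f)
    (LLam (LApp (cup B G) (LApp f (LApp (cdn A G) SVar)))).
  by apply: (eqtm_eqlr erefl (beta_Arr _ _)); rewrite /vsub /= !sub_isoE.
by rewrite beta_Lolli !lsubE.
Qed.

Lemma LApp_vdn_Lolli G D A B f (u : tm G D (VComp A)) :
  eqtm (LApp (App (vdn (VLolli A B) G) f) u)
    (LApp (cdn B G) (LApp f (LApp (cup A G) u))).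
Proof.
have -> : eqtm (App (vdn (VLolli A B) G) f)
    (LLam (LApp (cdn B G) (LApp f (LApp (cup A G) SVar)))).
  by apply: (eqtm_eqlr erefl (beta_Arr _ _)); rewrite /vsub /= !sub_isoE.
by rewrite beta_Lolli !lsubE.
Qed.

Lemma LApp_cup_With G D A B (t : tm G D (VComp (CWith A B))) :
  eqtm (LApp (cup (CWith A B) G) t)
    (CPair (LApp (cup A G) (CFst t)) (LApp (cup B G) (CSnd t))).
Proof. by apply: (eqtm_eqlr erefl (beta_Lolli _ _)); rewrite !lsubE. Qed.

Lemma LApp_cdn_With G D A B t :
  eqtm (@LApp _ _ G D _ _ (cdn (CWith A B) G) t)
    (CPair (LApp (cdn A G) (CFst t)) (LApp (cdn B G) (CSnd t))).
Proof. by apply: (eqtm_eqlr erefl (beta_Lolli _ _)); rewrite !lsubE. Qed.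

Lemma CApp_cup_Arr G D X B (t : tm G D (VComp (CArr X B))) u :
  eqtm (CApp (LApp (cup (CArr X B) G) t) u)
    (LApp (cup B G) (CApp t (App (vdn X G) u))).
Proof.
have -> : eqtm (LApp (cup (CArr X B) G) t)
    (CLam (LApp (cup B _) (CApp (wk _ t) (App (vdn X _) (Var VZ))))).
  by apply: (eqtm_eqlr erefl (beta_Lolli _ _)); rewrite !lsubE.
apply: (eqtm_eqlr erefl (beta_CArr _ _)); rewrite /vsub /= !sub_isoE.
by case: D t => [Z|] t; syn.
Qed.

Lemma CApp_cdn_Arr G D X B t u :
  eqtm (CApp (@LApp _ _ G D _ _ (cdn (CArr X B) G) t) u)
    (LApp (cdn B G) (CApp t (App (vup X G) u))).
Proof.
have -> : eqtm (LApp (cdn (CArr X B) G) t)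
    (CLam (LApp (cdn B _) (CApp (wk _ t) (App (vup X _) (Var VZ))))).
  by apply: (eqtm_eqlr erefl (beta_Lolli _ _)); rewrite !lsubE.
apply: (eqtm_eqlr erefl (beta_CArr _ _)); rewrite /vsub /= !sub_isoE.
by case: D t => [Z|] t; syn.
Qed.

Lemma LApp_cup_Bang G D X (t : tm G D (VComp (CBang X))) :
  eqtm (LApp (cup (CBang X) G) t)
    (LetBang t (Tens (App (vup X _) (Var VZ)) (LApp (castL (esym hI) _) Top))).
Proof. by apply: (eqtm_eqlr erefl (beta_Lolli _ _)); rewrite !lsubE. Qed.

Lemma LApp_cdn_Bang G D X t :
  eqtm (@LApp _ _ G D _ _ (cdn (CBang X) G) t)
    (LetTens t (LetTop (LApp (castL hI _) SVar)
      (Bang (App (vdn X _) (Var VZ))))).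
Proof. by apply: (eqtm_eqlr erefl (beta_Lolli _ _)); rewrite !lsubE. Qed.

Lemma LApp_cup_Tens G D X B (t : tm G D (VComp (CTens X B))) :
  eqtm (LApp (cup (CTens X B) G) t)
    (LetTens t (Tens (App (vup X _) (Var VZ)) (LApp (cup B _) SVar))).
Proof. by apply: (eqtm_eqlr erefl (beta_Lolli _ _)); rewrite !lsubE. Qed.

Lemma LApp_cdn_Tens G D X B t :
  eqtm (@LApp _ _ G D _ _ (cdn (CTens X B) G) t)
    (LetTens t (Tens (App (vdn X _) (Var VZ)) (LApp (cdn B _) SVar))).
Proof. by apply: (eqtm_eqlr erefl (beta_Lolli _ _)); rewrite !lsubE. Qed.

Lemma LApp_cup_Plus G D A B (t : tm G D (VComp (CPlus A B))) :
  eqtm (LApp (cup (CPlus A B) G) t)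
    (Case t (Inl _ (LApp (cup A _) SVar)) (Inr _ (LApp (cup B _) SVar))).
Proof. by apply: (eqtm_eqlr erefl (beta_Lolli _ _)); rewrite !lsubE. Qed.

Lemma LApp_cdn_Plus G D A B t :
  eqtm (@LApp _ _ G D _ _ (cdn (CPlus A B) G) t)
    (Case t (Inl _ (LApp (cdn A _) SVar)) (Inr _ (LApp (cdn B _) SVar))).
Proof. by apply: (eqtm_eqlr erefl (beta_Lolli _ _)); rewrite !lsubE. Qed.

Lemma cup_Tens G D X B (a : tm G None X) (b : tm G D (VComp B)) :
  eqtm (LApp (cup (CTens X B) G) (Tens a b))
    (Tens (App (vup X G) a) (LApp (cup B G) b)).
Proof. by rewrite LApp_cup_Tens beta_Tens /vlsub /= !sub_isoE. Qed.

Lemma cdn_Tens G D X B a (b : tm G D (VComp (ctr R (ctr R B)))) :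
  eqtm (LApp (cdn (CTens X B) G) (Tens a b))
    (Tens (App (vdn X G) a) (LApp (cdn B G) b)).
Proof.
rewrite (LApp_cdn_Tens (X := X) (B := B)) beta_Tens /vlsub /=.
by rewrite !sub_isoE.
Qed.

Lemma cup_Bang G X (a : tm G None X) :
  eqtm (LApp (cup (CBang X) G) (Bang a))
    (Tens (App (vup X G) a) (LApp (castL (esym hI) _) Top)).
Proof. by rewrite LApp_cup_Bang beta_Bang /vsub /= !sub_isoE. Qed.

Lemma cdn_Bang G D X a (b : tm G D (VComp (ctr R R))) :
  eqtm (LApp (cdn (CBang X) G) (Tens a b))
    (LetTop (LApp (castL hI _) b) (Bang (App (vdn X G) a))).
Proof.
rewrite (LApp_cdn_Bang (X := X)) beta_Tens /vlsub /=.
by rewrite !sub_isoE.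
Qed.

(** At each constructor the computation rules bring the two directions together, the induction
    hypotheses cancel them, and an eta rule closes the case. *)
Lemma iso_inverse :
  (forall X,
     (forall G t, eqtm (App (vdn X G) (App (vup X G) t)) t) /\
     (forall G t, eqtm (App (vup X G) (App (vdn X G) t)) t)) /\
  (forall A,
     (forall G D (t : tm G D (VComp A)),
        eqtm (LApp (cdn A G) (LApp (cup A G) t)) t) /\
     (forall G D (t : tm G D (VComp (ctr R (ctr R A)))),
        eqtm (LApp (cup A G) (LApp (cdn A G) t)) t)).
Proof.
apply: vctype_ind.
- by move=> a; split=> G t; rewrite App_vup_Const App_vdn_Const.
- by split=> G t; apply: (eqtm_trans (eta_One _)); symmetry; apply: eta_One.
- move=> X [IX IX'] Y [IY IY']; split=> G t.
  + by rewrite App_vup_Prod App_vdn_Prod beta_Fst beta_Snd IX IY eta_Prod.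
  + by rewrite App_vdn_Prod App_vup_Prod beta_Fst beta_Snd IX' IY' eta_Prod.
- move=> X [IX IX'] Y [IY IY']; split=> G t.
  + apply: Arr_ext; rewrite !wk_App !wk_isoE App_vdn_Arr App_vup_Arr.
    by rewrite IX IY.
  + apply: Arr_ext; rewrite !wk_App !wk_isoE App_vup_Arr App_vdn_Arr.
    by rewrite IX' IY'.
- move=> A [IA IA']; split=> G t.
  + by rewrite App_vdn_Comp LApp_vup_Comp castLVK beta_I IA.
  (* By eta for I, a linear map out of R° ≅ I is determined by its value at the unit. *)
  + apply: Lolli_ext; rewrite LApp_vup_Comp App_vdn_Comp IA' -LApp_LetTop.
    by rewrite LetTop_LApp castLK.
- move=> A [IA IA'] B [IB IB']; split=> G t; apply: Lolli_ext.
  + by rewrite LApp_vdn_Lolli LApp_vup_Lolli IA IB.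
  + by rewrite LApp_vup_Lolli LApp_vdn_Lolli IA' IB'.
- by move=> a; split=> G D t; [apply: castLVK|apply: castLK].
- split=> G D t; apply: (eqtm_trans (eta_COne _)); symmetry;
  exact: eta_COne.
- move=> A [IA IA'] B [IB IB']; split=> G D t.
  + by rewrite LApp_cup_With LApp_cdn_With beta_CFst beta_CSnd IA IB eta_With.
  + by rewrite LApp_cdn_With LApp_cup_With beta_CFst beta_CSnd IA' IB' eta_With.
- move=> X [IX IX'] B [IB IB']; split=> G D t.
  + apply: CArr_ext; rewrite !wk_LApp !wk_isoE CApp_cdn_Arr CApp_cup_Arr.
    by rewrite IX IB.
  + apply: CArr_ext; rewrite !wk_LApp !wk_isoE CApp_cup_Arr CApp_cdn_Arr.
    by rewrite IX' IB'.
- by split=> G D t; [apply: castLVK|apply: castLK].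
- move=> X [IX IX']; split=> G D t.
  + rewrite LApp_cup_Bang LApp_LetBang wk_isoE cdn_Bang castLVK beta_I IX.
    exact: LetBang_Bang.
  + rewrite LApp_cdn_Bang LApp_LetTens wk_isoE LApp_LetTop cup_Bang IX'.
    (* Eta for I in the second component of the tensor: taking the stoup apart and putting the unit
       back gives the stoup again. *)
    have := eta_I (LApp (castL hI _) SVar) (Tens (Var VZ)
      (LApp (castL (esym hI) (vtr R (vtr R X) :: G)) SVar)).
    rewrite !lsubE => ->; rewrite castLK.
    exact: LetTens_Tens.
- move=> X [IX IX'] B [IB IB']; split=> G D t.
  + rewrite LApp_cup_Tens LApp_LetTens wk_isoE cdn_Tens IX IB.
    exact: LetTens_Tens.
  + rewrite LApp_cdn_Tens LApp_LetTens wk_isoE cup_Tens IX' IB'.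
    exact: LetTens_Tens.
- by split=> G D t; apply: (eqtm_trans (beta_Lolli _ _)); apply: beta_Lolli.
- move=> A [IA IA'] B [IB IB']; split=> G D t.
  + rewrite LApp_cup_Plus LApp_Case !LApp_cdn_Plus beta_Inl beta_Inr !lsubE.
    by rewrite IA IB Case_Inl_Inr.
  + rewrite LApp_cdn_Plus LApp_Case !LApp_cup_Plus beta_Inl beta_Inr !lsubE.
    by rewrite IA' IB' Case_Inl_Inr.
Qed.

Lemma vupK X G t : eqtm (App (vdn X G) (App (vup X G) t)) t.
Proof. by case: iso_inverse => h _; case: (h X). Qed.

Lemma vdnK X G t : eqtm (App (vup X G) (App (vdn X G) t)) t.
Proof. by case: iso_inverse => h _; case: (h X). Qed.

Lemma cupK A G D (t : tm G D (VComp A)) :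
  eqtm (LApp (cdn A G) (LApp (cup A G) t)) t.
Proof. by case: iso_inverse => _ h; case: (h A). Qed.

Lemma cdnK A G D (t : tm G D (VComp (ctr R (ctr R A)))) :
  eqtm (LApp (cup A G) (LApp (cdn A G) t)) t.
Proof. by case: iso_inverse => _ h; case: (h A). Qed.

(** * Pulling terms over Γ•• back to Γ *)

Local Notation ctx2 G := (ctxtr R (ctxtr R G)).

(** The eliminator is nested because the context is translated twice. *)
Definition up_subst G : subst (ctx2 G) G :=
  var_tr_rect (T := tm G None)
    (var_tr_rect (T := fun Y => tm G None (vtr R Y))
       (fun X x => App (vup X G) (Var x))).

Definition dn_subst G : subst G (ctx2 G) :=
  fun X x => App (vdn X _) (Var (vartr R (vartr R x))).

Lemma up_substE G X (x : var G X) :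
  up_subst (vartr R (vartr R x)) = App (vup X G) (Var x).
Proof. by rewrite /up_subst !var_tr_rectE. Qed.

Lemma var_tr2_ind G (P : forall Y, var (ctx2 G) Y -> Prop) :
  (forall X (x : var G X), P _ (vartr R (vartr R x))) -> forall Y x, P Y x.
Proof.
move=> h; apply: var_tr_ind.
exact: (var_tr_ind (P := fun Y x => P _ (vartr R x))).
Qed.

(** For the empty stoup this is the unit of R° ≅ I. *)
Definition up_stoup G D : tm G D (VComp (ctr R (stoup_tr R D))) :=
  match D return tm G D (VComp (ctr R (stoup_tr R D))) with
  | None => LApp (castL (esym hI) G) Top
  | Some A => LApp (cup A G) SVar
  end.

Lemma wk_up_stoup G D X : wk X (up_stoup G D) = up_stoup (X :: G) D.
Proof. by case: D => [A|]; rewrite /= wk_LApp wk_isoE. Qed.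

Definition pullc G D B
    (u : tm (ctx2 G) (Some (ctr R (stoup_tr R D))) (VComp B)) :
    tm G D (VComp B) :=
  sub u (up_subst (G := G)) (SOne (up_stoup G D)).

Definition pullv G Y (u : tm (ctx2 G) None Y) : tm G None Y :=
  sub u (up_subst (G := G)) SNil.

#[local] Instance pullc_Proper G D B :
  Proper (@eqtm V K _ _ _ ==> @eqtm V K _ _ _) (@pullc G D B).
Proof. by move=> t u h; apply: eqtm_sub. Qed.

#[local] Instance pullv_Proper G Y :
  Proper (@eqtm V K _ _ _ ==> @eqtm V K _ _ _) (@pullv G Y).
Proof. by move=> t u h; apply: eqtm_sub. Qed.

(** Substituting back along [dn_subst] undoes the pullback, by [vdnK] at each variable. *)
Lemma pullv_inj G Y (t u : tm (ctx2 G) None Y) :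
  eqtm (pullv t) (pullv u) -> eqtm t u.
Proof.
have E (w : tm (ctx2 G) None Y) :
    eqtm (sub (pullv w) (dn_subst (G := G)) SNil) w.
  rewrite /pullv sub_sub -{2}(sub_id w); apply: eqtm_subst => //.
  apply: var_tr2_ind => X x; rewrite up_substE /= sub_isoE.
  exact: vdnK.
by move=> h; rewrite -(E t) -(E u); apply: eqtm_sub.
Qed.

Lemma pullc_inj G A B (t u : tm (ctx2 G) (Some (ctr R (ctr R A))) (VComp B)) :
  eqtm (pullc (D := Some A) t) (pullc (D := Some A) u) -> eqtm t u.
Proof.
have E (w : tm (ctx2 G) (Some (ctr R (ctr R A))) (VComp B)) :
    eqtm (sub (pullc (D := Some A) w) (dn_subst (G := G))
            (SOne (LApp (cdn A _) SVar))) w.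
  rewrite /pullc sub_sub -{2}(sub_id w); apply: eqtm_subst.
    apply: var_tr2_ind => X x; rewrite up_substE /= sub_isoE.
    exact: vdnK.
  by rewrite /= sub_isoE; apply: cdnK.
by move=> h; rewrite -(E t) -(E u); apply: eqtm_sub.
Qed.

Lemma up_subst_cons G X :
  up_subst (G := X :: G) =
  scons (B := vtr R (vtr R X)) (App (vup X _) (Var VZ))
    (fun Y x => wk X (up_subst x)).
Proof.
apply: subst_ext; apply: (var_tr2_ind (G := X :: G)) => Y x.
rewrite up_substE; elim/var_cons_ind: Y / x => //= Y x.
by rewrite up_substE wk_App wk_isoE.
Qed.

(** Below a binder, pulling back leaves the new variable at type X••, whereas the induction
    hypothesis of naturality has it at type X. Inserting [vdn] reconciles the two. *)
Definition dn_last G D X Y (t : tm (X :: G) D Y) :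
    tm (vtr R (vtr R X) :: G) D Y :=
  sub t (scons (App (vdn X _) (Var VZ)) (fun Y x => Var (VS _ x)))
    (ssub_id _ D).

Lemma App_wk_Lam G X Y (t : tm (X :: G) None Y) :
  eqtm (App (wk _ (Lam t)) (App (vdn X _) (Var VZ))) (dn_last t).
Proof. by rewrite /wk /= beta_Arr /dn_last; apply: eqtm_eq; syn. Qed.

Lemma CApp_wk_CLam G D X B (t : tm (X :: G) D (VComp B)) :
  eqtm (CApp (wk _ (CLam t)) (App (vdn X _) (Var VZ))) (dn_last t).
Proof.
rewrite /wk /= beta_CArr /dn_last; apply: eqtm_eq.
by case: D t => [Z|] t; syn.
Qed.

Lemma sup_up_subst G X Y (x : var (ctx2 (X :: G)) Y) :
  eqtm (sup (B := vtr R (vtr R X)) (up_subst (G := G)) x)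
    (sub (up_subst x)
      (scons (App (vdn X _) (Var VZ)) (fun Y x => Var (VS _ x))) SNil).
Proof.
rewrite up_subst_cons; elim/var_cons_ind: Y / x => [|Y x] /=.
  by rewrite sub_isoE vdnK.
by apply: eqtm_eq; syn.
Qed.

Lemma sup_pullv G X Y (t : tm (ctx2 (X :: G)) None Y) :
  eqtm (sub t (sup (B := vtr R (vtr R X)) (up_subst (G := G))) SNil)
    (dn_last (pullv t)).
Proof.
rewrite /dn_last /pullv sub_sub; apply: eqtm_subst => //.
exact: sup_up_subst.
Qed.

Lemma sup_pullc G D X B
    (t : tm (ctx2 (X :: G)) (Some (ctr R (stoup_tr R D))) (VComp B)) :
  eqtm (sub t (sup (B := vtr R (vtr R X)) (up_subst (G := G)))
          (SOne (up_stoup _ D)))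
    (dn_last (pullc t)).
Proof.
rewrite /dn_last /pullc sub_sub; apply: eqtm_subst.
  exact: sup_up_subst.
by case: D t => [A|] t; rewrite /= sub_isoE.
Qed.

(* Naturality t•• ∘ i = i ∘ t of the isomorphisms i; with an empty stoup and a
   computation type, i at the stoup is I ≅ R° applied to the unit. *)
Definition natural G D X : tm G D X -> Prop :=
  match X return tm G D X -> Prop with
  | VComp B => fun t => eqtm (pullc (ttc R t)) (LApp (cup B G) t)
  | Y => match D return tm G D Y -> Prop with
         | None => fun t => eqtm (pullv (tr R (tr R t))) (App (vup Y G) t)
         | Some _ => fun=> True
         end
  end.

(** At a computation type, [natural] compares two maps out of R° ≅ I only at the unit, which
    suffices by eta for I. *)
Lemma naturalE G X (t : tm G None X) :
  natural t <-> eqtm (pullv (tr R (tr R t))) (App (vup X G) t).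
Proof.
case: X t => // B t; rewrite /natural.
have -> : pullc (ttc R t) =
    LApp (A := ctr R R) (B := ctr R (ctr R B))
      (pullv (tr R (tr R t))) (LApp (castL (esym hI) G) Top).
  by [].
split=> [h|->]; last by rewrite LApp_vup_Comp castLVK beta_I.
apply: (Lolli_ext (A := ctr R R) (B := ctr R (ctr R B))).
by rewrite LApp_vup_Comp -h -LApp_LetTop LetTop_LApp castLK.
Qed.

Lemma naturalC G D B (t : tm G D (VComp B)) :
  natural t <-> eqtm (pullc (ttc R t)) (LApp (cup B G) t).
Proof. by []. Qed.

Lemma dn_last_LApp G D X A (t : tm (X :: G) D (VComp A)) :
  dn_last (LApp (cup A _) t) = LApp (cup A _) (dn_last t).
Proof. by rewrite /dn_last /= sub_isoE. Qed.

Lemma dn_last_App G X Y (t : tm (X :: G) None Y) :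
  dn_last (App (vup Y _) t) = App (vup Y _) (dn_last t).
Proof. by rewrite /dn_last /= sub_isoE. Qed.

#[local] Instance dn_last_Proper G D X Y :
  Proper (@eqtm V K _ _ _ ==> @eqtm V K _ _ _) (@dn_last G D X Y).
Proof. by move=> t u h; apply: eqtm_sub. Qed.

Lemma lsub_sub_up G D A C Y (v : tm (ctx2 G) (Some A) Y)
    (a : tm G (Some C) (VComp A)) (b : tm G D (VComp C)) :
  lsub (sub v (up_subst (G := G)) (SOne a)) b =
  sub v (up_subst (G := G)) (SOne (lsub a b)).
Proof.
rewrite /lsub sub_sub; apply: sub_ext => //.
by apply: subst_ext => X x; apply: sub_id.
Qed.

Lemma pullc_lsub G D A B (v : tm (ctx2 G) (Some A) (VComp B))
    (a : tm (ctx2 G) (Some (ctr R (stoup_tr R D))) (VComp A)) :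
  pullc (lsub v a) = sub v (up_subst (G := G)) (SOne (pullc (D := D) a)).
Proof. by rewrite /lsub /pullc sub_sub. Qed.

Lemma pullc_LetTens G D X B C
    (s : tm (ctx2 G) (Some (ctr R (stoup_tr R D)))
      (VComp (CTens (vtr R (vtr R X)) B)))
    (t : tm (ctx2 (X :: G)) (Some B) (VComp C)) :
  pullc (D := D) (LetTens (A := vtr R (vtr R X)) s t) =
  LetTens (pullc s)
    (sub t (sup (B := vtr R (vtr R X)) (up_subst (G := G))) (SOne SVar)).
Proof. by []. Qed.

(** In the let rules [cup] of the scrutinee puts [vup] on the bound variable. This turns the lifted
    substitution into [up_subst] of the longer context, where the induction hypothesis applies. *)
Lemma sub_sup_up G X D A Y (v : tm (ctx2 (X :: G)) (Some A) Y)
    (b : tm (X :: G) D (VComp A)) :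
  sub (sub v (sup (B := vtr R (vtr R X)) (up_subst (G := G))) (SOne SVar))
    (scons (App (vup X _) (Var VZ)) (fun Y x => Var (VS _ x))) (SOne b) =
  sub v (up_subst (G := X :: G)) (SOne b).
Proof.
rewrite up_subst_cons sub_sub; apply: sub_ext => //.
by apply: (subst_ext_cons (G := ctx2 G)) => //= Z x; rewrite /wk sub_ren renE.
Qed.

(** In an elimination the isomorphism on the scrutinee meets a beta rule or a commuting conversion;
    in an introduction the computation rule of the isomorphism applies; abstractions are compared
    after eta expansion. *)
Lemma tr_natural G D X (t : tm G D X) : natural t.
Proof.
elim: t => {G D X}.
- by move=> G X x; apply/naturalE; apply: eqtm_eq; exact: up_substE.
- by move=> G; apply/naturalE; symmetry; exact: eta_One.
- move=> G X Y t /naturalE IHt u /naturalE IHu; apply/naturalE.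
  apply: (eqtm_trans (eqtm_Pair IHt IHu)).
  by rewrite App_vup_Prod beta_Fst beta_Snd.
- move=> G X Y t /naturalE IH; apply/naturalE.
  apply: (eqtm_trans (eqtm_Fst IH)).
  by rewrite App_vup_Prod beta_Fst.
- move=> G X Y t /naturalE IH; apply/naturalE.
  apply: (eqtm_trans (eqtm_Snd IH)).
  by rewrite App_vup_Prod beta_Snd.
- move=> G X Y t /naturalE IH; apply/naturalE.
  apply: (eqtm_trans (eqtm_Lam (sup_pullv (tr R (tr R t))))).
  symmetry; apply: (eqtm_trans (eqtm_sym (eta_Arr _))); apply: eqtm_Lam.
  by rewrite wk_App wk_isoE App_vup_Arr App_wk_Lam IH dn_last_App.
- move=> G X Y t /naturalE IHt u /naturalE IHu; apply/naturalE.
  apply: (eqtm_trans (eqtm_App IHt IHu)).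
  by rewrite App_vup_Arr vupK.
- by move=> G A; apply/naturalC.
- move=> G D; apply/naturalC; symmetry.
  exact: (eqtm_trans (eta_COne _) (eqtm_sym (eta_COne _))).
- move=> G D A B t /naturalC IHt u /naturalC IHu; apply/naturalC.
  rewrite ttc_CPair; apply: (eqtm_trans (eqtm_CPair IHt IHu)).
  by rewrite LApp_cup_With beta_CFst beta_CSnd.
- move=> G D A B t /naturalC IH; apply/naturalC.
  rewrite ttc_CFst; apply: (eqtm_trans (eqtm_CFst IH)).
  by rewrite LApp_cup_With beta_CFst.
- move=> G D A B t /naturalC IH; apply/naturalC.
  rewrite ttc_CSnd; apply: (eqtm_trans (eqtm_CSnd IH)).
  by rewrite LApp_cup_With beta_CSnd.
- move=> G D X B t /naturalC IH; apply/naturalC.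
  rewrite ttc_CLam {1}/pullc /= wk_up_stoup.
  apply: (eqtm_trans (eqtm_CLam (sup_pullc (ttc R t)))).
  symmetry; apply: (eqtm_trans (eqtm_sym (eta_CArr _))); apply: eqtm_CLam.
  by rewrite wk_LApp wk_isoE CApp_cup_Arr CApp_wk_CLam IH dn_last_LApp.
- move=> G D X B s /naturalC IHs t /naturalE IHt; apply/naturalC.
  rewrite ttc_CApp; apply: (eqtm_trans (eqtm_CApp IHs IHt)).
  by rewrite CApp_cup_Arr vupK.
- by move=> G; apply/naturalC; rewrite ttc_Top.
- move=> G D A t /naturalC IHt u /naturalC IHu; apply/naturalC.
  rewrite ttc_LetTop LApp_LetTop -IHu pullc_lsub.
  (* The image of the unit under [cup CI] is [up_stoup] at the empty stoup. So the right-hand side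
     is an eta redex for I whose body is [ttc R u] with stoup fed by [cup CI]. *)
  have := eta_I t (sub (ttc R u) (up_subst (G := G))
    (SOne (LApp (cup CI _) SVar))).
  rewrite !lsub_sub_up !lsubE => ->.
  by apply: eqtm_subst.
- move=> G X t /naturalE IH; apply/naturalC; rewrite ttc_Bang cup_Bang.
  exact: (eqtm_Tens IH).
- move=> G D X B t /naturalC IHt u /naturalC IHu; apply/naturalC.
  rewrite ttc_LetBang pullc_LetTens IHt.
  rewrite LApp_cup_Bang LetTens_LetBang LApp_LetBang wk_isoE -IHu.
  by apply: eqtm_LetBang => //; apply: eqtm_eq; exact: (sub_sup_up (ttc R u)).
- move=> G D X B t /naturalE IHt u /naturalC IHu; apply/naturalC.
  rewrite ttc_Tens cup_Tens; exact: (eqtm_Tens IHt IHu).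
- move=> G D X B C s /naturalC IHs t /naturalC IHt; apply/naturalC.
  rewrite ttc_LetTens pullc_LetTens IHs.
  rewrite LApp_cup_Tens LetTens_LetTens LApp_LetTens wk_isoE -IHt.
  by apply: eqtm_LetTens => //; apply: eqtm_eq; exact: (sub_sup_up (ttc R t)).
- move=> G D A t /naturalC IH; apply/naturalC.
  rewrite ttc_Abort LApp_Abort; apply: (eqtm_trans (eqtm_Abort _ IH)).
  (* [cup CZero] is the identity. *)
  by apply: eqtm_Abort; apply: beta_Lolli.
- move=> G D A B t /naturalC IH; apply/naturalC.
  rewrite ttc_Inl; apply: (eqtm_trans (eqtm_Inl _ IH)).
  by rewrite LApp_cup_Plus beta_Inl !lsubE.
- move=> G D A B t /naturalC IH; apply/naturalC.
  rewrite ttc_Inr; apply: (eqtm_trans (eqtm_Inr _ IH)).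
  by rewrite LApp_cup_Plus beta_Inr !lsubE.
- move=> G D A B C s /naturalC IHs t /naturalC IHt u /naturalC IHu.
  apply/naturalC.
  rewrite ttc_Case.
  apply: (eqtm_trans (eqtm_Case IHs (eqtm_refl _) (eqtm_refl _))).
  rewrite LApp_cup_Plus Case_Case LApp_Case -IHt -IHu.
  by rewrite !lsub_sub_up !lsubE.
- move=> G A B t /naturalC IH; apply/naturalE.
  apply: (Lolli_ext (A := ctr R (ctr R A)) (B := ctr R (ctr R B))).
  rewrite LApp_vup_Lolli beta_Lolli -lsub_LApp -IH /pullc lsub_sub_up !lsubE.
  apply: (eqtm_trans (beta_Lolli _ _)); rewrite lsub_SVarr.
  by apply: eqtm_subst => //; apply: eqtm_sym; apply: cdnK.
- move=> G D A B s /naturalE IHs t /naturalC IHt; apply/naturalC.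
  rewrite ttc_LApp; apply: (eqtm_trans (eqtm_LApp IHs IHt)).
  by rewrite LApp_vup_Lolli cupK.
Qed.

Lemma pullv_tr G X (t : tm G None X) :
  eqtm (pullv (tr R (tr R t))) (App (vup X G) t).
Proof. exact/naturalE/tr_natural. Qed.

Lemma pullc_ttc G D B (t : tm G D (VComp B)) :
  eqtm (pullc (ttc R t)) (LApp (cup B G) t).
Proof. exact: (tr_natural t). Qed.

Lemma vtrans_faithful G X (t u : tm G None X) :
  eqtm (vtrans R t) (vtrans R u) -> eqtm t u.
Proof.
move=> h; have {}h : eqtm (tr R (tr R t)) (tr R (tr R u)) := tr_sound R h.
by rewrite -(vupK t) -(vupK u) -!pullv_tr h.
Qed.

Lemma vtrans_full G X (t : tm (ctxtr R G) None (vtr R X)) :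
  exists u : tm G None X, eqtm t (vtrans R u).
Proof.
(* Faithfulness over the translated context reduces the goal to u•• = t•, and [pullv_inj] to the
   pullback of it. By naturality the left side is then [vup] of the witness, where [vup] cancels
   [vdn]. *)
exists (App (vdn X G) (pullv (tr R t))); symmetry.
by apply: vtrans_faithful; apply: pullv_inj; rewrite /vtrans pullv_tr vdnK.
Qed.

Lemma ctrans_faithful G A B (t u : tm G (Some A) (VComp B)) :
  eqtm (ctrans R t) (ctrans R u) -> eqtm t u.
Proof.
move=> h; have {}h : eqtm (ttc R t) (ttc R u) := trc_sound R h.
by rewrite -(cupK t) -(cupK u) -!pullc_ttc h.
Qed.

Lemma ctrans_full G A B
    (t : tm (ctxtr R G) (Some (ctr R B)) (VComp (ctr R A))) :
  exists u : tm G (Some A) (VComp B), eqtm t (ctrans R u).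
Proof.
exists (LApp (cdn B G) (pullc (D := Some A) (trc R t))); symmetry.
apply: ctrans_faithful; apply: pullc_inj.
by rewrite (pullc_ttc (LApp _ _)) cdnK.
Qed.

End Iso.

Theorem theorem5p5 (V : Type) (K : eqType) (R : ctype V K)
    (hR : (exists r : K, R = CConst r) \/ R = CI) :
  (forall (G : ctx V K) (A : vtype V K) (t u : tm G None A),
      eqtm (vtrans R t) (vtrans R u) -> eqtm t u) /\
  (forall (G : ctx V K) (A : vtype V K) (t : tm (ctxtr R G) None (vtr R A)),
      exists u : tm G None A, eqtm t (vtrans R u)) /\
  (forall (G : ctx V K) (A B : ctype V K) (t u : tm G (Some A) (VComp B)),
      eqtm (ctrans R t) (ctrans R u) -> eqtm t u) /\
  (forall (G : ctx V K) (A B : ctype V K)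
      (t : tm (ctxtr R G) (Some (ctr R B)) (VComp (ctr R A))),
      exists u : tm G (Some A) (VComp B), eqtm t (ctrans R u)).
Proof.
have hI : ctr R R = CI by case: hR => [[r]|] -> //=; rewrite eqxx.
(* A constant equal to R goes to I and back; any other constant is fixed. *)
have hK a : ctr R (ctr R (CConst a)) = CConst a.
  case: hR => [[r]|] -> //=; case: (eqVneq a r) => [->|/negPf ne] //=.
  by rewrite ne.
split; first exact: (vtrans_faithful hI hK).
split; first exact: (vtrans_full hI hK).
split; first exact: (ctrans_faithful hI hK).
exact: (ctrans_full hI hK).
Qed.
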